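(* For every $x\in W_{\mathrm{af}}$ with $x\ne \mathrm{id}$ one has $\xi^{x^{-1}}(r_\theta)\in\theta S$. Moreover $$ j_{r_0} \;=\; A_{r_0}+\sum_{\mathrm{id}\ne x\in W}\left(\theta^{-1}\,\xi^{x^{-1}}(r_\theta)\,A_x+\xi^{x^{-1}}(r_\theta)\,A_{r_0x}\right). $$
   Context: Let $G$ be a simple, simply connected algebraic group over $\mathbb{C}$ with maximal torus $T$, finite Dynkin node set $I$, $I_{\mathrm{af}}=I\cup\{0\}$, weight lattice $P$, simple roots $\alpha_i$ ($i\in I$), highest root $\theta$ with coroot $\theta^\vee$, coroot lattice $Q^\vee$, and finite Weyl group $W$. Let $r_\theta\in W$ be the reflection in $\theta$. The affine Weyl group is $W_{\mathrm{af}}=W\ltimes Q^\vee$; the element of $W_{\mathrm{af}}$ corresponding to $\mu\in Q^\vee$ is denoted $t_\mu$ (so $wt_\mu w^{-1}=t_{w\mu}$), and $r_0=t_{\theta^\vee}r_\theta$. It is a Coxeter group with simple generators $r_i$, $i\in I_{\mathrm{af}}$, length function $\ell$ and Bruhat order $\le$. Let $W_{\mathrm{af}}^0$ be the set of minimal length representatives of the cosets in $W_{\mathrm{af}}/W$. Let $S=\mathrm{Sym}(P)$ and $Q=\mathrm{Frac}(S)$. $W_{\mathrm{af}}$ acts on $P$, hence on $S$ and $Q$, by the level zero action $wt_\mu\cdot\lambda=w\cdot\lambda$ ($w\in W$, $\mu\in Q^\vee$); in particular $r_0$ acts as $r_\theta$. In $S$ set $\alpha_0=-\theta$. Let $Q_{W_{\mathrm{af}}}=\bigoplus_{w\in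 W_{\mathrm{af}}}Qw$ be the skew group ring, with product $(pv)(qw)=p(v\cdot q)\,vw$ for $p,q\in Q$, $v,w\in W_{\mathrm{af}}$. For $i\in I_{\mathrm{af}}$ put $A_i=\alpha_i^{-1}(1-r_i)$, and for a reduced expression $w=r_{i_1}\cdots r_{i_\ell}$ put $A_w=A_{i_1}\cdots A_{i_\ell}$ (independent of the reduced expression). The level zero affine nilHecke ring is the subring $\mathbb{A}=\bigoplus_{w\in W_{\mathrm{af}}}SA_w$ of $Q_{W_{\mathrm{af}}}$ generated by $S$ and the $A_i$; it contains $W_{\mathrm{af}}$ since $r_i=1-\alpha_iA_i$. For $v,w\in W_{\mathrm{af}}$ the elements $\xi^v(w)\in S$ are defined by $$w=\sum_{v\in W_{\mathrm{af}}}(-1)^{\ell(v)}\xi^v(w)A_v\quad\text{in }\mathbb{A}.$$ Let $\mathbb{P}=Z_{\mathbb{A}}(S)$ be the centralizer of $S$ in $\mathbb{A}$ (the Peterson subalgebra, isomorphic to the $T$-equivariant homology of the affine Grassmannian of $G$). For $w\in W_{\mathrm{af}}^0$, $j_w=\sum_{x\in W_{\mathrm{af}}}j_w^xA_x$ (with $j_w^x\in S$) denotes the unique element of $\mathbb{P}$ such that $j_w^w=1$ and $j_w^x=0$ for all $x\in W_{\mathrm{af}}^0\setminus\{w\}$ (by Peterson's theorem such an element exists and is unique; it is the image of the Schubert class $\xi_w$). *)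

(* Defs.v *)
From HB Require Import structures.
From Stdlib Require Import ClassicalEpsilon.
From mathcomp Require Import all_boot all_order all_algebra all_fingroup.
From mathcomp Require Import generic_quotient.
From mathcomp Require Import finmap.
From mathcomp Require Import monalg.

Set Implicit Arguments.
Unset Strict Implicit.
Unset Printing Implicit Defensive.

Import GRing.Theory.
Local Open Scope ring_scope.

Record ringAction (G : groupType) (K : comNzRingType) := RingAction {
  ract :> G -> {rmorphism K -> K};
  ract1 : forall q, ract 1%g q = q;
  ractM : forall v w q, ract (v * w)%g q = ract v (ract w q)
}.

Definition skewRing (G : groupType) (K : comNzRingType) (act : ringAction G K)
  : Type := {malg K[G]}.

HB.instance Definition _ (G : groupType) (K : comNzRingType)
    (act : ringAction G K) := GRing.Lmodule.copy (skewRing act) {malg K[G]}.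

HB.lock Definition skmul (G : groupType) (K : comNzRingType)
    (act : ringAction G K) (x y : skewRing act) : skewRing act :=
  \sum_(v <- msupp x) \sum_(w <- msupp y) << x@_v * act v y@_w *g (v * w)%g >>.

Arguments skmul {G K act}.

Section SkewRing.
Context (G : groupType) (K : comNzRingType) (act : ringAction G K).
Local Notation skew := (skewRing act).
Local Notation skmul := (@skmul G K act).

Implicit Types (x y z : skew).

Definition skone : skew := << 1 *g 1%g >>.

Local Open Scope fset_scope.

Lemma skmulw (d1 d2 : {fset G}) x y :
  msupp x `<=` d1 -> msupp y `<=` d2 ->
  skmul x y =
  \sum_(v <- d1) \sum_(w <- d2) << x@_v * act v y@_w *g (v * w)%g >>.
Proof.
move=> le1 le2; rewrite skmul.unlock (big_fset_incl _ le1) /=.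
  apply/eq_bigr=> v _; apply/big_fset_incl => // k _ /mcoeff_outdom ->.
  by rewrite rmorph0 mulr0 monalgU0.
move=> v _ /mcoeff_outdom xv.
by rewrite big1 => // w _; rewrite xv mul0r monalgU0.
Qed.

Lemma skmulDl : left_distributive skmul +%R.
Proof.
move=> x y z.
rewrite [skmul x z](skmulw (fsubsetUl _ (msupp y)) (fsubset_refl _)).
rewrite [skmul y z](skmulw (fsubsetUr (msupp x) _) (fsubset_refl _)).
rewrite (skmulw (msuppD_le _ _) (fsubset_refl _)).
rewrite -big_split /=; apply/eq_bigr=> v _.
rewrite -big_split /=; apply/eq_bigr=> w _.
by rewrite mcoeffD mulrDl monalgUD.
Qed.

Lemma skmulDr : right_distributive skmul +%R.
Proof.
move=> z x y.
rewrite [skmul z x](skmulw (fsubset_refl _) (fsubsetUl _ (msupp y))).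
rewrite [skmul z y](skmulw (fsubset_refl _) (fsubsetUr (msupp x) _)).
rewrite (skmulw (fsubset_refl _) (msuppD_le _ _)).
rewrite -big_split /=; apply/eq_bigr=> v _.
rewrite -big_split /=; apply/eq_bigr=> w _.
by rewrite mcoeffD rmorphD mulrDr monalgUD.
Qed.

Lemma skmul0x : left_zero 0 skmul.
Proof. by move=> x; rewrite skmul.unlock msupp0 big_seq_fset0. Qed.

Lemma skmulx0 : right_zero 0 skmul.
Proof.
by move=> x; rewrite skmul.unlock big1 // => v _; rewrite msupp0 big_seq_fset0.
Qed.

Lemma skmulUU p q v w :
  skmul << p *g v >> << q *g w >> = << p * act v q *g (v * w)%g >>.
Proof. by rewrite (skmulw msuppU_le msuppU_le) !big_seq_fset1 !mcoeffUU. Qed.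

Lemma skmulEl x y : skmul x y = \sum_(v <- msupp x) skmul << x@_v *g v >> y.
Proof.
rewrite {1}skmul.unlock; apply/eq_bigr=> v _.
rewrite (skmulw msuppU_le (fsubset_refl _)) big_seq_fset1.
by apply/eq_bigr=> w _; rewrite mcoeffUU.
Qed.

Lemma skmulEr x y : skmul x y = \sum_(w <- msupp y) skmul x << y@_w *g w >>.
Proof.
rewrite {1}skmul.unlock exchange_big; apply/eq_bigr=> w _.
rewrite (skmulw (fsubset_refl _) msuppU_le); apply/eq_bigr=> v _.
by rewrite big_seq_fset1 mcoeffUU.
Qed.

Lemma skmul_suml I (r : seq I) (F : I -> skew) y :
  skmul (\sum_(i <- r) F i) y = \sum_(i <- r) skmul (F i) y.
Proof.
exact: (big_morph (skmul^~ y) (fun _ _ => skmulDl _ _ _) (skmul0x _)).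
Qed.

Lemma skmul_sumr I (r : seq I) (F : I -> skew) y :
  skmul y (\sum_(i <- r) F i) = \sum_(i <- r) skmul y (F i).
Proof.
exact: (big_morph (skmul y) (fun _ _ => skmulDr _ _ _) (skmulx0 _)).
Qed.

Lemma skmulA : associative skmul.
Proof.
move=> x y z; rewrite (skmulEl x) (skmulEl x) skmul_suml; apply/eq_bigr=> u _.
rewrite (skmulEl y) (skmulEr _ y) skmul_sumr skmul_suml.
apply/eq_bigr=> v _.
rewrite (skmulEr _ z) [RHS]skmulEr skmul_sumr; apply/eq_bigr=> w _.
by rewrite !skmulUU ractM rmorphM mulrA mulgA.
Qed.

Lemma skmul1x : left_id skone skmul.
Proof.
move=> x; rewrite skmulEr [RHS]monalgE; apply/eq_bigr=> v _.
by rewrite skmulUU ract1 mul1r mul1g.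
Qed.

Lemma skmulx1 : right_id skone skmul.
Proof.
move=> x; rewrite skmulEl [RHS]monalgE; apply/eq_bigr=> v _.
by rewrite skmulUU rmorph1 mulr1 mulg1.
Qed.

Lemma skone_neq0 : skone != 0.
Proof. by rewrite monalgU_eq0 oner_eq0. Qed.

HB.instance Definition _ := GRing.Zmodule_isNzRing.Build skew
  skmulA skmul1x skmulx1 skmulDl skmulDr skone_neq0.

End SkewRing.

Notation "x %:F" := (@FracField.tofrac _ x) : ring_scope.

HB.lock Definition fracmap (D : idomainType) (f : {rmorphism D -> D})
    of injective f := fun x : {fraction D} =>
  (f (frac (repr x)).1)%:F / (f (frac (repr x)).2)%:F.

Arguments fracmap {D f}.

Section FracMap.
Context (D : idomainType) (f : {rmorphism D -> D}).

Lemma fracE (x : {fraction D}) :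
  x = (frac (repr x)).1%:F / (frac (repr x)).2%:F.
Proof.
have d0 : (frac (repr x)).2%:F != 0 :> {fraction D}.
  by rewrite tofrac_eq0 denom_ratioP.
apply: (mulIf d0); rewrite divfK //; elim/quotW: x {d0} => r; rewrite !piE.
apply/eqmodP; rewrite /= FracField.equivfE /FracField.mulf.
rewrite !numden_Ratio ?mulf_neq0 ?oner_eq0 ?denom_ratioP //.
by rewrite !mulr1; apply/eqP; exact: FracField.equivf_r.
Qed.

Context (f_inj : injective f).

Lemma frmorph_neq0 c : c != 0 -> (f c)%:F != 0 :> {fraction D}.
Proof. by rewrite tofrac_eq0 -(inj_eq f_inj) rmorph0. Qed.

Lemma fracmapE a b :
  b != 0 -> fracmap f_inj (a%:F / b%:F) = (f a)%:F / (f b)%:F.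
Proof.
move=> b0; rewrite fracmap.unlock; set r := repr _.
have r0 : (frac r).2 != 0 by exact: denom_ratioP.
apply/eqP; rewrite eqr_div ?frmorph_neq0 // -!tofracM -!rmorphM tofrac_eq.
rewrite (inj_eq f_inj) -tofrac_eq !tofracM -eqr_div ?tofrac_eq0 //.
by rewrite -fracE.
Qed.

Lemma fracP (x : {fraction D}) : exists a b : D, b != 0 /\ x = a%:F / b%:F.
Proof.
exists (frac (repr x)).1, (frac (repr x)).2.
by split; [exact: denom_ratioP|exact: fracE].
Qed.

Lemma fracmap_zmod : zmod_morphism (fracmap f_inj).
Proof.
move=> x y; have [a [b [b0 ->]]] := fracP x; have [c [d [d0 ->]]] := fracP y.
rewrite -mulNr -tofracN addf_div ?tofrac_eq0 // -!tofracM -tofracD.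
rewrite !fracmapE ?mulf_neq0 // !rmorphD !rmorphM !rmorphN.
by rewrite -mulNr addf_div ?frmorph_neq0.
Qed.

Lemma fracmap_tofrac a : fracmap f_inj a%:F = (f a)%:F.
Proof.
by rewrite -[a%:F]divr1 -tofrac1 fracmapE ?oner_eq0 // rmorph1 tofrac1 divr1.
Qed.

Lemma fracmap_monoid : monoid_morphism (fracmap f_inj).
Proof.
split=> [|x y]; first by rewrite -tofrac1 fracmap_tofrac rmorph1.
have [a [b [b0 ->]]] := fracP x; have [c [d [d0 ->]]] := fracP y.
by rewrite mulf_div -!tofracM !fracmapE ?mulf_neq0 // !rmorphM mulf_div.
Qed.

HB.instance Definition _ := GRing.isZmodMorphism.Build
  {fraction D} {fraction D} (fracmap f_inj) fracmap_zmod.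
HB.instance Definition _ := GRing.isMonoidMorphism.Build
  {fraction D} {fraction D} (fracmap f_inj) fracmap_monoid.

End FracMap.

(* The root datum (P, Phi, Q^vee, Phi^vee) of a simple, simply connected      *)
(* group of rank n, with a base.  Simple connectedness says that the          *)
(* cocharacter lattice is the coroot lattice Q^vee; hence Q^vee = Z^n in the  *)
(* basis of simple coroots, and the character lattice is the weight lattice   *)
(* P = Z^n in the dual basis of fundamental weights.  The roots are indexed   *)
(* by the finite type Phi.  An irreducible root system with a base has a      *)
(* unique highest root, so that theta is not additional structure.            *)

Definition pairing n (lambda mu : 'rV[int]_n) : int :=
  \sum_i lambda 0 i * mu 0 i.

Record simpleRootDatum (n : nat) := SimpleRootDatum {
  Phi :> finType;
  rootv : Phi -> 'rV[int]_n;
  corootv : Phi -> 'rV[int]_n;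
  root_inj : injective rootv;
  pairing_root_coroot : forall a, pairing (rootv a) (corootv a) = 2;
  (* sroot a b is the root s_a(b). *)
  sroot : Phi -> Phi -> Phi;
  root_sroot : forall a b,
    rootv (sroot a b) = rootv b - pairing (rootv b) (corootv a) *: rootv a;
  coroot_sroot : forall a b,
    corootv (sroot a b) =
      corootv b - pairing (rootv a) (corootv b) *: corootv a;
  root_reduced : forall a b (k l : int), k != 0 ->
    k *: rootv b = l *: rootv a -> rootv b = rootv a \/ rootv b = - rootv a;
  root_irreducible : forall A : {set Phi},
    (forall a b, a \in A -> b \notin A -> pairing (rootv a) (corootv b) = 0) ->
    A = set0 \/ A = setT;
  simple_root : 'I_n -> Phi;
  coroot_simple : forall i, corootv (simple_root i) = delta_mx 0 i;
  simple_free : forall c : 'I_n -> int,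
    \sum_i c i *: rootv (simple_root i) = 0 -> forall i, c i = 0;
  simple_base : forall a, exists c : 'I_n -> nat,
    rootv a = \sum_i (c i)%:Z *: rootv (simple_root i) \/
    rootv a = - \sum_i (c i)%:Z *: rootv (simple_root i);
  theta : Phi;
  theta_highest : forall a, exists c : 'I_n -> nat,
    rootv theta - rootv a = \sum_i (c i)%:Z *: rootv (simple_root i)
}.

Section Weyl.
Context (n : nat) (R : simpleRootDatum n).

Lemma pairingBl (x y z : 'rV[int]_n) :
  pairing (x - y) z = pairing x z - pairing y z.
Proof. by rewrite -sumrB; apply: eq_bigr => i _; rewrite !mxE mulrBl. Qed.

Lemma pairingZl k (x z : 'rV[int]_n) : pairing (k *: x) z = k * pairing x z.
Proof. by rewrite mulr_sumr; apply: eq_bigr => i _; rewrite !mxE mulrA. Qed.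

Lemma srootK (a : R) : involutive (sroot a).
Proof.
move=> b; apply: root_inj; rewrite !root_sroot pairingBl pairingZl.
rewrite pairing_root_coroot -addrA -opprD -scalerDl.
by rewrite mulr_natr mulr2n opprD addNKr subrr scale0r subr0.
Qed.

Definition srefl (a : R) : {perm R} := perm (can_inj (srootK a)).

(* Permutations compose from left to right in MathComp, so that the left      *)
(* action on roots of w : {perm R}, seen as an element of the Weyl group, is  *)
(* w^-1; see the lemmas coroot_act and root_act below.                        *)
Definition weyl_group : {group {perm R}} := <<[set srefl a | a : R]>>%G.

Definition W : finGroupType := subg_of weyl_group.

Definition act_root (w : W) (a : R) : R := (val w)^-1%g a.

Definition coroot_mx (s : {perm R}) : 'M[int]_n :=
  \matrix_i corootv (s (simple_root R i)).

(* alpha_i^vee |-> (w alpha_i)^vee, extended by linearity *)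
Definition act_coweight (w : W) (mu : 'rV[int]_n) : 'rV[int]_n :=
  mu *m coroot_mx (val w)^-1.

(* <w lambda, mu> = <lambda, w^-1 mu> *)
Definition act_weight (w : W) (lambda : 'rV[int]_n) : 'rV[int]_n :=
  lambda *m (coroot_mx (val w))^T.

Lemma coroot_perm s a :
  s \in weyl_group -> corootv (s a) = corootv a *m coroot_mx s.
Proof.
pose lin := [set s : {perm R} |
  [forall a, corootv (s a) == corootv a *m coroot_mx s]].
have linP (t : {perm R}) :
    reflect (forall b, corootv (t b) = corootv b *m coroot_mx t) (t \in lin).
  by rewrite inE; apply: (iffP forallP) => h b; apply/eqP.
suff /subsetP sub : weyl_group \subset lin by move=> /sub/linP.
have lin_group : group_set lin.
  apply/group_setP; split=> [|t u /linP lt /linP lu].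
    apply/linP => b; rewrite perm1 [coroot_mx _](_ : _ = 1%:M) ?mulmx1 //.
    by apply/row_matrixP => i; rewrite rowK perm1 coroot_simple row1.
  apply/linP => b; rewrite permM lu lt -mulmxA; congr (_ *m _).
  by apply/row_matrixP => i; rewrite row_mul !rowK permM lu.
rewrite (_ : lin = Group lin_group) // gen_subG.
apply/subsetP => _ /imsetP[b _ ->].
apply/linP => c; rewrite permE coroot_sroot; apply/rowP => k; rewrite !mxE.
under eq_bigr => i _ do
  rewrite mxE permE coroot_sroot coroot_simple !mxE mulrBr.
rewrite sumrB (bigD1 k) //= eqxx mulr1 big1 ?addr0 => [|i /negbTE ik];
  last first.
  by rewrite eq_sym ik mulr0.
congr (_ - _); rewrite mulr_suml; apply: eq_bigr => i _.
rewrite mulrA; congr (_ * _).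
rewrite mulrC; congr (_ * _); rewrite /pairing (bigD1 i) //= mxE !eqxx.
rewrite mulr1 big1 ?addr0 //.
by move=> j /negbTE ij; rewrite mxE ij andbF mulr0.
Qed.

Lemma coroot_mxM s t :
  t \in weyl_group -> coroot_mx (s * t) = coroot_mx s *m coroot_mx t.
Proof.
by move=> tW; apply/row_matrixP => i; rewrite row_mul !rowK permM coroot_perm.
Qed.

Lemma coroot_mx1 : coroot_mx 1 = 1%:M.
Proof. by apply/row_matrixP => i; rewrite rowK perm1 coroot_simple row1. Qed.

Lemma act_coweight1 mu : act_coweight 1 mu = mu.
Proof. by rewrite /act_coweight /= invg1 coroot_mx1 mulmx1. Qed.

Lemma act_coweightM v w mu :
  act_coweight (v * w) mu = act_coweight v (act_coweight w mu).
Proof.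
by rewrite /act_coweight /= invMg coroot_mxM ?groupV ?(valP v) // mulmxA.
Qed.

Lemma act_weight1 lambda : act_weight 1 lambda = lambda.
Proof. by rewrite /act_weight coroot_mx1 trmx1 mulmx1. Qed.

Lemma act_weightM v w lambda :
  act_weight (v * w) lambda = act_weight v (act_weight w lambda).
Proof. by rewrite /act_weight coroot_mxM ?(valP w) // trmx_mul mulmxA. Qed.

Lemma coroot_act w a : corootv (act_root w a) = act_coweight w (corootv a).
Proof. by rewrite /act_root coroot_perm // groupV (valP w). Qed.

Lemma act_weightE w lambda mu :
  pairing (act_weight w lambda) mu = pairing lambda (act_coweight w^-1 mu).
Proof.
have pE (x y : 'rV[int]_n) : pairing x y = (x *m y^T) ord0 ord0.
  by rewrite mxE; apply: eq_bigr => i _; rewrite !mxE.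
by rewrite !pE /act_weight /act_coweight /= invgK trmx_mul mulmxA.
Qed.

Lemma srefl_subproof a : srefl a \in weyl_group.
Proof. exact/mem_gen/imset_f. Qed.

Definition reflection (a : R) : W := Subg (srefl_subproof a).

Lemma act_weight_reflection a lambda :
  act_weight (reflection a) lambda =
  lambda - pairing lambda (corootv a) *: rootv a.
Proof.
apply/rowP => k; rewrite !mxE.
under eq_bigr => i _ do
  rewrite !mxE permE coroot_sroot coroot_simple !mxE mulrBr.
rewrite sumrB (bigD1 k) //= !eqxx mulr1 big1 ?addr0 => [|i /negbTE ik];
  last first.
  by rewrite ik mulr0.
congr (_ - _); rewrite mulr_suml; apply: eq_bigr => i _.
rewrite mulrA [RHS]mulrAC; congr (_ * _ * _).
rewrite /pairing (bigD1 k) //= mxE !eqxx mulr1 big1 ?addr0 // => j /negbTE jk.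
by rewrite mxE jk andbF mulr0.
Qed.

Lemma root_act w a : rootv (act_root w a) = act_weight w (rootv a).
Proof.
suff rP (s : {perm R}) b :
    s \in weyl_group -> rootv (s b) *m (coroot_mx s)^T = rootv b.
  have wV : (val w)^-1%g \in weyl_group by rewrite groupV (valP w).
  rewrite -[in RHS](rP _ _ wV) /act_weight -mulmxA -trmx_mul -coroot_mxM //.
  by rewrite mulgV coroot_mx1 trmx1 mulmx1.
move: s b; pose lin := [set s in weyl_group |
  [forall b, rootv (s b) *m (coroot_mx s)^T == rootv b]].
have linP (t : {perm R}) : t \in weyl_group -> reflect
    (forall b, rootv (t b) *m (coroot_mx t)^T = rootv b) (t \in lin).
  by move=> tW; rewrite inE tW; apply: (iffP forallP) => h b; apply/eqP.
have linW t : t \in lin -> t \in weyl_group by rewrite inE => /andP[].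
suff /subsetP sub : weyl_group \subset lin.
  by move=> s b sW; apply/(linP _ sW)/sub.
have lin_group : group_set lin.
  apply/group_setP; split=> [|t u tl ul].
    by apply/linP => // b; rewrite perm1 coroot_mx1 trmx1 mulmx1.
  have [tW uW] := (linW _ tl, linW _ ul).
  apply/linP => [|b]; first exact: groupM.
  rewrite permM coroot_mxM // trmx_mul mulmxA.
  by move/(linP _ uW): ul => ->; move/(linP _ tW): tl => ->.
rewrite (_ : lin = Group lin_group) // gen_subG.
apply/subsetP => _ /imsetP[a' _ ->].
apply/linP => [|b]; first exact: srefl_subproof.
have := act_weight_reflection a' (rootv (srefl a' b)).
rewrite /act_weight /= => ->; by rewrite -root_sroot permE srootK.
Qed.

End Weyl.

(* The pair (mu, w) stands for t_mu w. *)
Definition Waf n (R : simpleRootDatum n) : Type := ('rV[int]_n * W R)%type.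

Section AffineWeyl.
Context (n : nat) (R : simpleRootDatum n).

HB.instance Definition _ := Choice.copy (Waf R) ('rV[int]_n * W R)%type.

Definition af_one : Waf R := (0, 1%g).

Definition af_mul (x y : Waf R) : Waf R :=
  (x.1 + act_coweight x.2 y.1, (x.2 * y.2)%g).

Definition af_inv (x : Waf R) : Waf R :=
  (- act_coweight x.2^-1%g x.1, x.2^-1%g).

Lemma af_mulA : associative af_mul.
Proof.
move=> x y z; congr (_, _); last exact: mulgA.
by rewrite /= act_coweightM [act_coweight x.2 (_ + _)]mulmxDl addrA.
Qed.

Lemma af_mul1 : left_id af_one af_mul.
Proof.
by case=> mu w; rewrite /af_mul /= act_coweight1 add0r mul1g.
Qed.

Lemma af_mulr1 : right_id af_one af_mul.
Proof.
by case=> mu w; rewrite /af_mul /= [act_coweight _ _]mul0mx addr0 mulg1.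
Qed.

Lemma af_mulV : left_inverse af_one af_inv af_mul.
Proof. by case=> mu w; rewrite /af_mul /= addNr mulVg. Qed.

Lemma af_mulrV : right_inverse af_one af_inv af_mul.
Proof.
case=> mu w; rewrite /af_mul /= [act_coweight w _]mulNmx.
by rewrite -[act_coweight w^-1 mu *m _]act_coweightM mulgV act_coweight1 subrr.
Qed.

HB.instance Definition _ := isGroup.Build (Waf R)
  af_mulA af_mul1 af_mulr1 af_mulV af_mulrV.

Definition transl (mu : 'rV[int]_n) : Waf R := (mu, 1%g).

Definition inW (w : W R) : Waf R := (0, w).

(* None is the affine node 0. *)
Definition Iaf : Type := option 'I_n.

Definition r_ (i : Iaf) : Waf R :=
  if i is Some i then inW (reflection (simple_root R i))
  else (transl (corootv (theta R)) * inW (reflection (theta R)))%g.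

Definition word (s : seq Iaf) : Waf R := (\prod_(i <- s) r_ i)%g.

Definition reduced (s : seq Iaf) : Prop :=
  forall s', word s' = word s -> (size s <= size s')%N.

(* A chosen reduced word of x *)
Definition redword (x : Waf R) : seq Iaf :=
  epsilon (inhabits [::]) (fun s => word s = x /\ reduced s).

Definition ell (x : Waf R) : nat := size (redword x).

(* x has minimal length in its coset x W *)
Definition Waf0 (x : Waf R) : Prop :=
  forall w : W R, (ell x <= ell (x * inW w)%g)%N.

End AffineWeyl.

From mathcomp Require Import mpoly.

(* monalg declares this notation too, for another type. *)
Local Notation "{ 'mpoly' T [ n ] }" := (mpoly.mpoly n T) : type_scope.

Local Notation "c @_ x" := (monalg.mcoeff x c) : ring_scope.

Lemma comp_mpolyA (D : comNzRingType) k l m (s : k.-tuple {mpoly D[l]})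
    (t : l.-tuple {mpoly D[m]}) (p : {mpoly D[k]}) :
  (p \mPo s) \mPo t = p \mPo [tuple tnth s i \mPo t | i < k].
Proof.
rewrite (comp_mpolyE p s) (comp_mpolyE p [tuple _ | _ < _]) raddf_sum /=.
apply: eq_bigr => e _; rewrite comp_mpolyZ rmorph_prod /=; congr (_ *: _).
by apply: eq_bigr => i _; rewrite rmorphXn tnth_mktuple.
Qed.

(* 'X_i is the i-th fundamental weight. *)
Definition weight n (lambda : 'rV[int]_n) : {mpoly int[n]} :=
  \sum_i lambda 0 i *: 'X_i.

HB.lock Definition act_Sym n (R : simpleRootDatum n) (w : W R)
    (p : {mpoly int[n]}) : {mpoly int[n]} :=
  p \mPo [tuple weight (act_weight w (delta_mx 0 i)) | i < n].

Arguments act_Sym {n R}.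

Section NilHecke.
Context (n : nat) (R : simpleRootDatum n).
Implicit Types v w : W R.

Lemma act_Sym_nmod w : nmod_morphism (act_Sym w).
Proof. by rewrite act_Sym.unlock; split=> [|p q]; rewrite ?raddf0 ?raddfD. Qed.

Lemma act_Sym_monoid w : monoid_morphism (act_Sym w).
Proof.
by rewrite act_Sym.unlock; split=> [|p q]; rewrite ?rmorph1 ?rmorphM.
Qed.

HB.instance Definition _ w := GRing.isNmodMorphism.Build
  {mpoly int[n]} {mpoly int[n]} (act_Sym w) (act_Sym_nmod w).
HB.instance Definition _ w := GRing.isMonoidMorphism.Build
  {mpoly int[n]} {mpoly int[n]} (act_Sym w) (act_Sym_monoid w).

Lemma act_Sym_weight w lambda :
  act_Sym w (weight lambda) = weight (act_weight w lambda).
Proof.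
rewrite act_Sym.unlock {1}/weight raddf_sum /=.
under eq_bigr => i _ do
  rewrite comp_mpolyZ comp_mpolyXU -tnth_nth tnth_mktuple scaler_sumr.
rewrite exchange_big; apply: eq_bigr => j _.
under eq_bigr => i _ do rewrite scalerA.
rewrite -scaler_suml; congr (_ *: _).
rewrite [in RHS](row_sum_delta lambda) /act_weight mulmx_suml summxE.
by apply: eq_bigr => i _; rewrite -scalemxAl [RHS]mxE.
Qed.

Lemma act_SymM v w p : act_Sym (v * w)%g p = act_Sym v (act_Sym w p).
Proof.
rewrite act_Sym.unlock comp_mpolyA; congr (_ \mPo _); apply: eq_mktuple => i.
by rewrite tnth_mktuple act_weightM -act_Sym_weight act_Sym.unlock.
Qed.

Lemma act_Sym1 p : act_Sym (1%g : W R) p = p.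
Proof.
rewrite -[RHS]comp_mpoly_id act_Sym.unlock; congr (_ \mPo _).
apply: eq_mktuple => i; rewrite act_weight1 /weight (bigD1 i) //= mxE !eqxx scale1r.
by rewrite big1 ?addr0 // => j /negbTE ji; rewrite mxE ji andbF scale0r.
Qed.

Lemma act_Sym_inj w : injective (act_Sym w).
Proof.
apply: (can_inj (g := act_Sym w^-1)) => p.
by rewrite -act_SymM mulVg act_Sym1.
Qed.

(* The symmetric algebra of P over Z. *)
Definition SymP : idomainType := {mpoly int[n]}.

Definition FracSymP : fieldType := {fraction SymP}.

(* The level zero action: translations act trivially. *)
Definition act_Frac (x : Waf R) : {rmorphism FracSymP -> FracSymP} :=
  fracmap (@act_Sym_inj x.2).

Lemma act_Frac1 q : act_Frac 1%g q = q.
Proof.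
have [a [b [b0 ->]]] := fracP q.
rewrite /act_Frac /= fracmapE //; congr (_%:F / _%:F); exact: act_Sym1.
Qed.

Lemma act_FracM (v w : Waf R) q :
  act_Frac (v * w)%g q = act_Frac v (act_Frac w q).
Proof.
have [a [b [b0 ->]]] := fracP q.
have wb0 : act_Sym w.2 b != 0.
  by apply: contra_neq b0 => h; apply: (@act_Sym_inj w.2); rewrite h rmorph0.
rewrite /act_Frac /= (fracmapE (@act_Sym_inj w.2) a b0).
rewrite (fracmapE (@act_Sym_inj (v * w)%g.2) a b0).
rewrite (fracmapE (@act_Sym_inj v.2) (act_Sym w.2 a) wb0).
by congr (_%:F / _%:F); exact: act_SymM.
Qed.

Definition levelZero : ringAction (Waf R) FracSymP :=
  RingAction act_Frac1 act_FracM.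

Definition QWaf := skewRing levelZero.

Definition grp (x : Waf R) : QWaf := << 1 *g x >>.

Definition alpha (i : Iaf n) : 'rV[int]_n :=
  if i is Some i then rootv (simple_root R i) else - rootv (theta R).

Definition A_ (i : Iaf n) : QWaf :=
  (weight (alpha i))%:F^-1 *: (1 - grp (r_ R i)).

Definition Aw (x : Waf R) : QWaf := \prod_(i <- redword x) A_ i.

Definition SymQ (s : SymP) : QWaf := s%:F *: (1 : QWaf).

(* The subring of QWaf generated by S and the A_i; it contains 1 = SymQ 1. *)
Inductive nilHecke : QWaf -> Prop :=
| nilHecke_Sym s : nilHecke (SymQ s)
| nilHecke_A i : nilHecke (A_ i)
| nilHecke_sub a b : nilHecke a -> nilHecke b -> nilHecke (a - b)
| nilHecke_mul a b : nilHecke a -> nilHecke b -> nilHecke (a * b).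

Definition Peterson (a : QWaf) : Prop :=
  nilHecke a /\ forall s : SymP, a * SymQ s = SymQ s * a.

(* \sum_x c_x A_x, for a finitely supported family c *)
Definition Acomb (c : {malg SymP[Waf R]}) : QWaf :=
  \sum_(x <- monalg.msupp c) (c@_x)%:F *: Aw x.

(* This family, and the element chosen in j_, are unique. *)
Definition xi_family (w : Waf R) : {malg SymP[Waf R]} :=
  epsilon (inhabits 0) (fun c : {malg SymP[Waf R]} =>
    grp w = \sum_(v <- monalg.msupp c) ((-1) ^+ ell v * c@_v)%:F *: Aw v).

Definition xi (v w : Waf R) : SymP := (xi_family w)@_v.

Definition is_j (w : Waf R) (j : QWaf) : Prop :=
  Peterson j /\ exists c : {malg SymP[Waf R]},
    [/\ j = Acomb c, c@_w = 1 &
        forall x, Waf0 x -> x <> w -> c@_x = 0].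

Definition j_ (w : Waf R) : QWaf := epsilon (inhabits 0) (is_j w).

End NilHecke.

(* Main.v *)
Require Import Defs.
From HB Require Import structures.
From Stdlib Require Import Classical ClassicalEpsilon.
From mathcomp Require Import all_boot all_order all_algebra all_fingroup.
From mathcomp Require Import zify ring.
From mathcomp Require Import mpoly.
From mathcomp Require Import finmap monalg.

Set Implicit Arguments.
Unset Strict Implicit.
Unset Printing Implicit Defensive.

Import Order.TTheory GRing.Theory Num.Theory.
Local Open Scope ring_scope.
Local Notation "c @_ x" := (monalg.mcoeff x c) : ring_scope.

(** The whole formula collapses to
    theta^-1 (t - 1),  where t is the translation by the coroot of theta.
Put f_x = xi^(x^-1)(r_theta). Since A_0 = theta^-1 (r_0 - 1) and
A_(r_0 x) = A_0 A_x for x in W, the two terms of index x add up to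
theta^-1 f_x r_0 A_x. The symmetry
    w^-1 xi^v(w) = (-1)^l(v) xi^(v^-1)(w^-1),
taken at w = r_theta, says that r_theta is the sum of the (r_theta f_x) A_x over
x in W, so the sum of the f_x r_0 A_x is r_0 r_theta = t, its term x = 1 being
r_0; this is [peterson_thE]. Translations act trivially on S, so this element
commutes with S.

Its coefficients lie in S because theta is conjugate to a simple root: the
element theta^-1 (1 - r_theta) is then conjugate to some A_i, so it is an S-linear
combination of the A_v, which says that theta divides the coefficients of
r_theta other than the one of A_1 ([span_reflection], [theta_expansion]). Besides
r_0 itself, only elements x and r_0 x with x <> 1 in W occur, and they are not
minimal in their cosets. So the element has the defining properties of j_(r_0).

The defining properties determine it ([peterson_uniq]): by faithfulness of W on
the weights, an element of the centralizer of S is supported on translations,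
one for each coset of W, so it is determined by its sums over these cosets. But
A_x = A_y A_i for some i in I when x is not minimal, and the coset sums of any
multiple of A_i vanish.

All this supposes that the A_x are well defined and linearly independent. The
affine Weyl group is shown to satisfy the exchange condition through its action
on affine roots, positivity being the sign of a linear form ([apos_r],
[exchange]). It is generated by the r_i because every root pairs non-trivially
with a conjugate of theta ([theta_orbit]). For the independence of A_x from the reduced word
([indepP]), two words are first brought to a common beginning followed by words
in two letters i and j. There the braid relations need no case analysis on the
order of r_i r_j. By the Chevalley rule ([Aword_wt]), moving a weight across A_s
produces a correction term that depends only on the value w of the reduced word
s, so the difference of the two products intertwines the weights like w. The
reflections r_i and r_j generate a group that acts faithfully on the weights, unless it
is infinite, and then w cannot have both as descents ([rank2]). So the difference
is a multiple of w, and it vanishes because the coefficients of w agree. *)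

(** * Roots, heights and the highest root *)

Section Pairing.
Context (n : nat).
Implicit Types x y z : 'rV[int]_n.

Lemma pairingE x y : pairing x y = (x *m y^T) 0 0.
Proof. by rewrite mxE; apply: eq_bigr => i _; rewrite !mxE. Qed.

Lemma pairingDl x y z : pairing (x + y) z = pairing x z + pairing y z.
Proof. by rewrite !pairingE mulmxDl mxE. Qed.

Lemma pairingDr x y z : pairing z (x + y) = pairing z x + pairing z y.
Proof. by rewrite !pairingE raddfD mulmxDr mxE. Qed.

Lemma pairingNl x y : pairing (- x) y = - pairing x y.
Proof. by rewrite !pairingE mulNmx mxE. Qed.

Lemma pairingNr x y : pairing x (- y) = - pairing x y.
Proof. by rewrite !pairingE raddfN mulmxN mxE. Qed.

Lemma pairingZr k x y : pairing x (k *: y) = k * pairing x y.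
Proof. by rewrite !pairingE linearZ /= -scalemxAr mxE. Qed.

Lemma pairing_delta x i : pairing x (delta_mx 0 i) = x 0 i.
Proof. by rewrite pairingE trmx_delta -colE mxE. Qed.

End Pairing.

Section FiniteRoots.
Context (n : nat) (R : simpleRootDatum n).
Implicit Types (a b : R) (w : W R) (i j : 'I_n).

Local Notation srt := (simple_root R).
Local Notation th := (theta R).

Lemma act_root1 a : act_root 1 a = a.
Proof. by apply: root_inj; rewrite root_act act_weight1. Qed.

Lemma act_rootM v w a : act_root (v * w) a = act_root v (act_root w a).
Proof. by apply: root_inj; rewrite !root_act act_weightM. Qed.

Lemma act_rootK w : cancel (act_root w) (act_root w^-1).
Proof. by move=> a; rewrite -act_rootM mulVg act_root1. Qed.

Lemma act_rootVK w : cancel (act_root w^-1) (act_root w).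
Proof. by move=> a; rewrite -act_rootM mulgV act_root1. Qed.

Lemma act_reflection a b : act_root (reflection a) b = sroot a b.
Proof. by apply: root_inj; rewrite root_act act_weight_reflection root_sroot. Qed.

(** The Weyl group is given as a group of permutations of the roots, which are
among the weights. *)
Lemma act_weight_inj v w :
  (forall l, act_weight v l = act_weight w l) -> v = w.
Proof.
move=> h; apply/val_inj/(can_inj (@invgK _))/permP => a.
by apply: root_inj; have := h (rootv a); rewrite -!root_act.
Qed.

Lemma reflectionK a : (reflection a * reflection a)%g = 1%g.
Proof.
apply: act_weight_inj => l; rewrite act_weightM act_weight1.
rewrite !act_weight_reflection pairingBl pairingZl pairing_root_coroot.
by rewrite -addrA -opprD -scalerDl mulr_natr mulr2n opprD addNKr subrr scale0r subr0.
Qed.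

Lemma reflectionV a : (reflection a)^-1%g = reflection a.
Proof. by apply: (mulgI (reflection a)); rewrite mulgV reflectionK. Qed.

Lemma act_weightB w l m : act_weight w (l - m) = act_weight w l - act_weight w m.
Proof. by rewrite /act_weight mulmxBl. Qed.

Lemma act_weightD w l m : act_weight w (l + m) = act_weight w l + act_weight w m.
Proof. by rewrite /act_weight mulmxDl. Qed.

Lemma act_weightZ w k l : act_weight w (k *: l) = k *: act_weight w l.
Proof. by rewrite /act_weight -scalemxAl. Qed.

Lemma act_coweightD w l m : act_coweight w (l + m) = act_coweight w l + act_coweight w m.
Proof. by rewrite /act_coweight mulmxDl. Qed.

Lemma act_coweightZ w k l : act_coweight w (k *: l) = k *: act_coweight w l.
Proof. by rewrite /act_coweight -scalemxAl. Qed.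

Lemma act_coweight0 w : act_coweight w 0 = 0.
Proof. by rewrite /act_coweight mul0mx. Qed.

Lemma pairing_act w x y : pairing (act_weight w x) (act_coweight w y) = pairing x y.
Proof. by rewrite act_weightE -act_coweightM mulVg act_coweight1. Qed.

Lemma reflection_conj w a :
  (w * reflection a * w^-1)%g = reflection (act_root w a).
Proof.
apply: act_weight_inj => l.
rewrite !act_weightM !act_weight_reflection act_weightB act_weightZ.
rewrite -act_weightM mulgV act_weight1 root_act coroot_act.
by rewrite act_weightE invgK.
Qed.

Lemma act_coweight_reflection a m :
  act_coweight (reflection a) m = m - pairing (rootv a) m *: corootv a.
Proof.
have pC (x y : 'rV[int]_n) : pairing x y = pairing y x.
  by apply: eq_bigr => i _; rewrite mulrC.
apply/rowP => k; rewrite -!pairing_delta ![pairing _ (delta_mx 0 k)]pC.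
rewrite -reflectionV -act_weightE act_weight_reflection pairingBl pairingZl.
by rewrite pairingDr pairingNr pairingZr mulrC.
Qed.

(** The simple coordinates of a weight are rational, so they are scaled by the
square of the determinant of the matrix of simple roots, which keeps them
integral and leaves their signs unchanged. *)
Definition simple_mx : 'M[int]_n := \matrix_i rootv (srt i).
Definition scale : int := \det simple_mx ^+ 2.
Definition coord i (l : 'rV[int]_n) : int := (\det simple_mx *: (l *m \adj simple_mx)) 0 i.

Lemma scale_gt0 : 0 < scale.
Proof.
rewrite /scale lt0r sqr_ge0 andbT expf_neq0 //.
apply/det0P => -[v v0 vC]; move/negP: v0; apply.
apply/eqP/rowP => i; rewrite mxE.
have := @simple_free _ R (fun i => v 0 i); apply.
rewrite -[RHS]vC mulmx_sum_row. apply: eq_bigr => j _.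
by rewrite rowK.
Qed.

Lemma coordD i x y : coord i (x + y) = coord i x + coord i y.
Proof. by rewrite /coord mulmxDl scalerDr mxE. Qed.

Lemma coordN i x : coord i (- x) = - coord i x.
Proof. by rewrite /coord mulNmx scalerN mxE. Qed.

Lemma coordB i x y : coord i (x - y) = coord i x - coord i y.
Proof. by rewrite coordD coordN. Qed.

Lemma coordZ i k x : coord i (k *: x) = k * coord i x.
Proof. by rewrite /coord -scalemxAl scalerA mulrC -scalerA mxE. Qed.

Lemma coord_simple i j : coord i (rootv (srt j)) = scale *+ (i == j).
Proof.
have -> : rootv (srt j) = delta_mx 0 j *m simple_mx by rewrite -rowE rowK.
rewrite /coord -mulmxA mul_mx_adj mul_mx_scalar !mxE eqxx andTb /scale mulrA -expr2.
by rewrite mulr_natr.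
Qed.

Lemma coord_sum (c : 'I_n -> int) i :
  coord i (\sum_j c j *: rootv (srt j)) = scale * c i.
Proof.
have -> : coord i (\sum_j c j *: rootv (srt j)) = \sum_j coord i (c j *: rootv (srt j)).
  apply: (big_morph (coord i) (coordD i)).
  by rewrite -(scale0r 0) coordZ mul0r.
rewrite (bigD1 i) //= big1 ?addr0 => [|j /negbTE ji]; rewrite coordZ coord_simple.
  by rewrite eqxx mulr1n mulrC.
by rewrite eq_sym ji mulr0n mulr0.
Qed.

Lemma root_decomp a : exists c : 'I_n -> int,
  rootv a = \sum_i c i *: rootv (srt i) /\
  ((forall i, 0 <= c i) \/ (forall i, c i <= 0)).
Proof.
have [c [] e] := simple_base a.
  by exists (fun i => (c i)%:Z); split => //; left.
exists (fun i => - (c i)%:Z); split; last by right => i; lia.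
by rewrite e -sumrN; apply: eq_bigr => i _; rewrite scaleNr.
Qed.

Lemma scale_root a :
  scale *: rootv a = \sum_i coord i (rootv a) *: rootv (srt i).
Proof.
have [c [e _]] := root_decomp a.
rewrite {1}e scaler_sumr; apply: eq_bigr => i _.
by rewrite e coord_sum scalerA.
Qed.

Lemma root_neq0 a : rootv a <> 0.
Proof.
move=> h; have := pairing_root_coroot a; rewrite h /pairing big1 // => i _.
by rewrite mxE mul0r.
Qed.

Lemma root_coord_inj a b :
  (forall i, coord i (rootv a) = coord i (rootv b)) -> a = b.
Proof.
move=> h; apply: root_inj; apply/rowP => k; apply: (mulfI (lt0r_neq0 scale_gt0)).
have /rowP/(_ k) : scale *: rootv a = scale *: rootv b.
  by rewrite !scale_root; apply: eq_bigr => i _; rewrite h.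
by rewrite !mxE.
Qed.

Definition height (l : 'rV[int]_n) : int := \sum_i coord i l.

Lemma heightD x y : height (x + y) = height x + height y.
Proof. by rewrite -big_split; apply: eq_bigr => i _; rewrite coordD. Qed.

Lemma heightN x : height (- x) = - height x.
Proof. by rewrite -sumrN; apply: eq_bigr => i _; rewrite coordN. Qed.

Lemma heightB x y : height (x - y) = height x - height y.
Proof. by rewrite heightD heightN. Qed.

Lemma heightZ k x : height (k *: x) = k * height x.
Proof. by rewrite mulr_sumr; apply: eq_bigr => i _; rewrite coordZ. Qed.

Lemma height_simple i : height (rootv (srt i)) = scale.
Proof.
rewrite /height (bigD1 i) //= big1 => [|j /negbTE ji].
  by rewrite coord_simple eqxx addr0.
by rewrite coord_simple ji.
Qed.

Definition neg a : R := sroot a a.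

Lemma root_neg a : rootv (neg a) = - rootv a.
Proof.
rewrite root_sroot pairing_root_coroot.
by rewrite scaler_nat mulr2n opprD addNKr.
Qed.

Lemma coroot_neg a : corootv (neg a) = - corootv a.
Proof.
rewrite coroot_sroot pairing_root_coroot.
by rewrite scaler_nat mulr2n opprD addNKr.
Qed.

Lemma negK a : neg (neg a) = a.
Proof. by apply: root_inj; rewrite !root_neg opprK. Qed.

Lemma reflection_neg a : reflection (neg a) = reflection a.
Proof.
apply: act_weight_inj => l; rewrite !act_weight_reflection root_neg coroot_neg.
by rewrite pairingNr scalerN scaleNr opprK.
Qed.

Definition pos a : bool := 0 < height (rootv a).

Lemma root_signs a :
  (pos a /\ forall i, 0 <= coord i (rootv a)) \/
  (height (rootv a) < 0 /\ forall i, coord i (rootv a) <= 0).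
Proof.
have [c [e h]] := root_decomp a.
have s0 := scale_gt0.
have ce i : coord i (rootv a) = scale * c i by rewrite {1}e coord_sum.
have nz : ~ (forall i, coord i (rootv a) = 0).
  move=> z; apply: (@root_neq0 a); rewrite e big1 // => i _.
  by have := z i; rewrite ce => /eqP; rewrite mulf_eq0 gt_eqF //= => /eqP ->; rewrite scale0r.
case: h => h; [left | right].
  have g i : 0 <= coord i (rootv a) by rewrite ce; have := h i; nia.
  split=> //; rewrite /pos lt0r sumr_ge0 ?andbT //.
  apply/eqP => z; apply: nz => i; apply/eqP; move/eqP: z.
  by rewrite psumr_eq0 // => /allP /(_ i); rewrite mem_index_enum => /(_ isT).
have g i : coord i (rootv a) <= 0 by rewrite ce; have := h i; nia.
split=> //; have g' i : 0 <= - coord i (rootv a) by rewrite oppr_ge0.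
rewrite -oppr_gt0 -sumrN lt0r sumr_ge0 ?andbT //.
apply/eqP => z; apply: nz => i; apply/eqP; move/eqP: z.
rewrite psumr_eq0 // => /allP /(_ i); rewrite mem_index_enum => /(_ isT) /=.
by rewrite oppr_eq0.
Qed.

Lemma height_neq0 a : height (rootv a) != 0.
Proof. by case: (root_signs a) => [] [h _]; [exact: lt0r_neq0 | exact: ltr0_neq0]. Qed.

Lemma pos_neg a : pos (neg a) = ~~ pos a.
Proof. by rewrite /pos root_neg heightN; have := height_neq0 a; lia. Qed.

Lemma pos_simple i : pos (srt i).
Proof. by rewrite /pos height_simple scale_gt0. Qed.

Lemma coord_theta a i : coord i (rootv a) <= coord i (rootv th).
Proof.
have [c e] := theta_highest a.
rewrite -subr_ge0 -coordB e coord_sum; have := scale_gt0; nia.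
Qed.

Lemma height_theta a : height (rootv a) <= height (rootv th).
Proof. by apply: ler_sum => i _; exact: coord_theta. Qed.

(** All coordinates of theta are at least those of a. *)
Lemma height_theta_eq a : height (rootv th) <= height (rootv a) -> a = th.
Proof.
move=> h; apply: root_coord_inj => i; apply/eqP; rewrite -subr_eq0 -oppr_eq0 opprB.
have z : height (rootv th) - height (rootv a) == 0.
  by rewrite subr_eq0 eq_le h height_theta.
move: z; rewrite /height -sumrB psumr_eq0 => [|j _].
  by move=> /allP /(_ i); rewrite mem_index_enum => /(_ isT).
by rewrite subr_ge0 coord_theta.
Qed.

Lemma pos_theta : pos th.
Proof.
case/orP: (orbN (pos th)) => // h.
by have := height_theta (neg th); rewrite root_neg heightN; move: h (height_neq0 th); rewrite /pos; lia.
Qed.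

Lemma height_geN a : - height (rootv th) <= height (rootv a).
Proof. by have := height_theta (neg a); rewrite root_neg heightN; lia. Qed.

Lemma height_sroot a b :
  height (rootv (sroot a b)) = height (rootv b) - pairing (rootv b) (corootv a) * height (rootv a).
Proof. by rewrite root_sroot heightB heightZ. Qed.

(** Otherwise the reflection of a in theta would lie below -theta. *)
Lemma pairing_theta_le1 a :
  a <> th -> pairing (rootv a) (corootv th) <= 1.
Proof.
move=> ath; rewrite leNgt; apply/negP => h; apply/ath/height_theta_eq.
have := height_geN (sroot th a); rewrite height_sroot.
have := pos_theta; rewrite /pos; nia.
Qed.

Lemma coord_sroot i j a : i != j ->
  coord i (rootv (sroot (srt j) a)) = coord i (rootv a).
Proof.
move=> ij; rewrite root_sroot coordB coordZ coord_simple (negbTE ij).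
by rewrite mulr0n mulr0 subr0.
Qed.

Lemma root_multiple a b (k l : int) :
  k != 0 -> k *: rootv b = l *: rootv a -> b = a \/ b = neg a.
Proof.
move=> k0 e; have [h|h] := root_reduced k0 e; [left | right];
  by apply: root_inj; rewrite ?root_neg.
Qed.

(** The reflection in alpha_j changes only the coordinate of index j, and a
positive root other than alpha_j has another positive coordinate because the
root system is reduced. *)
Lemma pos_sroot j a : pos a -> a <> srt j -> pos (sroot (srt j) a).
Proof.
move=> pa aj; have [i ij ci] : exists2 i, i != j & coord i (rootv a) != 0.
  apply/exists_inP; rewrite -[X in is_true X]negbK negb_exists_in; apply/negP => /forall_inP h.
  have e : scale *: rootv a = coord j (rootv a) *: rootv (srt j).
    rewrite scale_root (bigD1 j) //= big1 ?addr0 // => i ij.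
    by have := h i ij; rewrite negbK => /eqP ->; rewrite scale0r.
  have s0 : scale != 0 by rewrite gt_eqF // scale_gt0.
  have [//|ea] := root_multiple s0 e.
  by move: pa; rewrite ea pos_neg pos_simple.
have ci' : 0 < coord i (rootv a).
  case: (root_signs a) => [] [h g]; first by have := g i; lia.
  by move: pa; rewrite /pos; lia.
have := coord_sroot a ij.
by case: (root_signs (sroot (srt j) a)) => [] [] // _ /(_ i); lia.
Qed.

(** Summing over all coroots makes the form invariant under W, and positive on
the roots since <a, a^v> = 2. *)
Definition form (x y : 'rV[int]_n) : int :=
  \sum_(b : R) pairing x (corootv b) * pairing y (corootv b).

Lemma form_act w x y : form (act_weight w x) (act_weight w y) = form x y.
Proof.
rewrite /form (reindex (act_root w)) /=; last first.
  by exists (act_root w^-1) => a _; rewrite ?act_rootK ?act_rootVK.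
by apply: eq_bigr => b _; rewrite coroot_act !pairing_act.
Qed.

Lemma formC x y : form x y = form y x.
Proof. by apply: eq_bigr => b _; rewrite mulrC. Qed.

Lemma formDl x y z : form (x + y) z = form x z + form y z.
Proof. by rewrite -big_split; apply: eq_bigr => b _; rewrite pairingDl mulrDl. Qed.

Lemma formZl k x z : form (k *: x) z = k * form x z.
Proof. by rewrite mulr_sumr; apply: eq_bigr => b _; rewrite pairingZl mulrA. Qed.

Lemma form_root_gt0 a : 0 < form (rootv a) (rootv a).
Proof.
rewrite /form (bigD1 a) //= pairing_root_coroot.
apply: ltr_wpDr => //; apply: sumr_ge0 => b _; exact: sqr_ge0.
Qed.

(** Invariance under the reflection in a, which changes the sign of a. *)
Lemma form_coroot a x :
  2 * form x (rootv a) = pairing x (corootv a) * form (rootv a) (rootv a).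
Proof.
have := form_act (reflection a) x (rootv a).
rewrite -root_act act_reflection root_neg act_weight_reflection.
rewrite formC -scaleN1r formZl formC formDl -scaleNr formZl; lia.
Qed.

Lemma coroot_orth_sym a b :
  pairing (rootv a) (corootv b) = 0 -> pairing (rootv b) (corootv a) = 0.
Proof.
have := form_coroot b (rootv a); have := form_coroot a (rootv b).
rewrite (formC (rootv b)); have := form_root_gt0 a; have := form_root_gt0 b; nia.
Qed.

Lemma form_scale_root a :
  scale * form (rootv a) (rootv a)
  = \sum_i coord i (rootv a) * form (rootv (srt i)) (rootv a).
Proof.
rewrite -formZl scale_root.
rewrite (big_morph (form^~ (rootv a)) (id1 := 0) (op1 := +%R)) => [|x y|]; last first.
- by rewrite /form big1 // => b _; rewrite /pairing big1 ?mul0r // => i _; rewrite mxE mul0r.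
- exact: formDl.
by apply: eq_bigr => i _; rewrite formZl.
Qed.

(** The height of a positive root that is not simple is lowered by some simple
reflection: the form being positive, the root pairs positively with the coroot
of a simple root that occurs in it. *)
Lemma pos_root_ind (P : R -> Prop) :
  (forall i, P (srt i)) ->
  (forall i a, P a -> P (sroot (srt i) a)) ->
  forall a, pos a -> P a.
Proof.
move=> P0 PS a; move: {2}`|height (rootv a)|%N (leqnn `|height (rootv a)|%N) => m.
elim: m a => [|m IH] a hm pa; first by move: pa hm; rewrite /pos; lia.
have [i ci] : exists i, 0 < pairing (rootv a) (corootv (srt i)).
  apply/existsP; rewrite -[X in is_true X]negbK negb_exists; apply/negP => /forallP h.
  have := form_scale_root a; have := form_root_gt0 a; have := scale_gt0.
  have : \sum_i coord i (rootv a) * form (rootv (srt i)) (rootv a) <= 0.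
    apply: sumr_le0 => i _.
    have := form_coroot (srt i) (rootv a); rewrite (formC (rootv (srt i))).
    have := form_root_gt0 (srt i); have := h i.
    case: (root_signs a) => [] [g /(_ i) gi]; last by move: pa; rewrite /pos; lia.
    nia.
  nia.
have [->|/eqP ai] := eqVneq a (srt i); first exact: P0.
rewrite -(srootK (srt i) a); have ps := pos_sroot pa ai; apply: PS; apply: IH => //.
move: ps pa hm; rewrite /pos height_sroot height_simple.
have := scale_gt0; nia.
Qed.

End FiniteRoots.

(** * The affine Weyl group acting on affine roots *)

Section AffineRoots.
Context (n : nat) (R : simpleRootDatum n).
Implicit Types (a : R) (w : W R) (x y : Waf R) (b : R * int) (i j : Iaf n) (s : seq (Iaf n)).

Local Notation th := (theta R).
Local Notation r := (r_ R).
Local Notation word := (@word n R).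

(** The pair (a, k) is the affine function mu |-> <a, mu> + k on coweights, on
which t_mu w acts through its affine action on coweights. *)
Definition aact x b : R * int :=
  (act_root x.2 b.1, b.2 - pairing (rootv (act_root x.2 b.1)) x.1).

Definition aneg b : R * int := (neg b.1, - b.2).

(** The reflection in the hyperplane where a + k vanishes, written as a
translation followed by its linear part. *)
Definition arefl b : Waf R := (- b.2 *: corootv b.1, reflection b.1).

Definition sroot_af i : R * int :=
  if i is Some i then (simple_root R i, 0) else (neg th, 1).

(** The usual positivity (k > 0, or k = 0 and a > 0) is the sign of this linear
form, since heights of roots are bounded by the height of theta; so positivity
is an additive condition. *)
Definition level b : int := height R (rootv b.1) + (height R (rootv th) + 1) * b.2.

Definition apos b : bool := 0 < level b.

Lemma aact1 b : aact 1%g b = b.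
Proof.
case: b => a k; rewrite /aact /= act_root1 /pairing big1 ?subr0 // => i _.
by rewrite mxE mulr0.
Qed.

Lemma aactM x y b : aact (x * y)%g b = aact x (aact y b).
Proof.
rewrite /aact /= act_rootM; congr (_, _).
by rewrite pairingDr [in X in _ - (_ + X)]root_act pairing_act addrAC opprD addrA.
Qed.

Lemma aactK x : cancel (aact x) (aact x^-1%g).
Proof. by move=> b; rewrite -aactM mulVg aact1. Qed.

Lemma act_root_neg w a : act_root w (neg a) = neg (act_root w a).
Proof.
by apply: root_inj; rewrite root_act !root_neg root_act -!scaleN1r act_weightZ.
Qed.

Lemma aact_neg x b : aact x (aneg b) = aneg (aact x b).
Proof.
rewrite /aact /aneg /= act_root_neg; congr (_, _).
by rewrite root_neg pairingNl opprD.
Qed.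

Lemma anegK b : aneg (aneg b) = b.
Proof. by case: b => a k; rewrite /aneg /= negK opprK. Qed.

Lemma level_neg b : level (aneg b) = - level b.
Proof. by rewrite /level /= root_neg heightN mulrN opprD. Qed.

Lemma level_neq0 b : level b != 0.
Proof.
rewrite /level; have := height_theta b.1; have := height_geN b.1.
have := height_neq0 b.1; have [->|[k1|k1]] : b.2 = 0 \/ 1 <= b.2 \/ b.2 <= -1 by lia.
- lia.
- nia.
- nia.
Qed.

Lemma apos_neg b : apos (aneg b) = ~~ apos b.
Proof. by rewrite /apos level_neg; have := level_neq0 b; lia. Qed.

Lemma apos_simple i : apos (sroot_af i).
Proof.
case: i => [i|]; rewrite /apos /level /=.
  by rewrite mulr0 addr0 height_simple scale_gt0.
by rewrite root_neg heightN; lia.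
Qed.

Lemma arefl_conj x b : (x * arefl b = arefl (aact x b) * x)%g.
Proof.
congr (_, _); rewrite /= /arefl /aact /=.
  rewrite act_coweightZ coroot_act act_coweight_reflection coroot_act.
  set u := pairing _ _; set c := act_coweight _ _.
  by apply/rowP => k; rewrite !mxE; ring.
by rewrite -reflection_conj mulgKV.
Qed.

Lemma r_arefl i : r i = arefl (sroot_af i).
Proof.
case: i => [i|]; rewrite /arefl /=; first by rewrite oppr0 scale0r.
rewrite coroot_neg reflection_neg scaleN1r opprK.
by congr (_, _); rewrite /= ?mul1g // act_coweight0 addr0.
Qed.

Lemma aact_arefl b : aact (arefl b) b = aneg b.
Proof.
rewrite /aact /arefl /aneg /= act_reflection -/(neg _) root_neg.
rewrite pairingNl pairingZr pairing_root_coroot; congr (_, _); lia.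
Qed.

Lemma arefl_neg b : arefl (aneg b) = arefl b.
Proof. by rewrite /arefl /= coroot_neg reflection_neg opprK scalerN scaleNr. Qed.

Lemma areflK b : (arefl b * arefl b = 1)%g.
Proof.
have e := arefl_conj (arefl b) b; rewrite aact_arefl arefl_neg in e.
congr (_, _); rewrite /= ?reflectionK // act_coweightZ act_coweight_reflection.
rewrite pairing_root_coroot scalerBr scalerA; set c := corootv _.
by rewrite -scalerBl -scalerDl (_ : _ + _ = 0) ?scale0r //; lia.
Qed.

Lemma r_K i : (r i * r i = 1)%g.
Proof. by rewrite r_arefl areflK. Qed.

Lemma r_V i : ((r i)^-1 = r i)%g.
Proof. by apply: (mulgI (r i)); rewrite mulgV r_K. Qed.

Lemma aact_r_self i : aact (r i) (sroot_af i) = aneg (sroot_af i).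
Proof. by rewrite r_arefl aact_arefl. Qed.

Lemma aact_r_Some (i : 'I_n) b :
  aact (r (Some i)) b = (sroot (simple_root R i) b.1, b.2).
Proof.
rewrite /aact /= act_reflection; congr (_, _).
by rewrite /pairing big1 ?subr0 // => k _; rewrite mxE mulr0.
Qed.

Lemma aact_r_None b :
  aact (r None) b = (sroot th b.1, b.2 + pairing (rootv b.1) (corootv th)).
Proof.
rewrite r_arefl /aact /arefl /= reflection_neg act_reflection; congr (_, _).
rewrite coroot_neg scaleN1r opprK root_sroot pairingBl pairingZl.
rewrite pairing_root_coroot; lia.
Qed.

(** For a finite node this is the statement for the finite root system. For the
node 0, the reflection changes the level by the pairing with the coroot of
theta, which is at least -1 except on the opposite of theta; and a level that is
not negative is positive. *)
Lemma apos_r i b : apos b -> b <> sroot_af i -> apos (aact (r i) b).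
Proof.
case: b => a k; case: i => [i|] /= pb bi.
  rewrite aact_r_Some /apos /level /=; move: pb; rewrite /apos /level /=.
  have := height_theta a; have := height_geN a.
  have := height_theta (sroot (simple_root R i) a).
  have := height_geN (sroot (simple_root R i) a).
  have [k0|k0] := eqVneq k 0; last first.
    move: (height R _) (height R _) (height R _) => u v t; nia.
  rewrite k0 mulr0 !addr0 => _ _ _ _ pa; apply: pos_sroot => // ai.
  by apply: bi; rewrite ai k0.
have e : level (aact (r None) (a, k)) = level (a, k) + pairing (rootv a) (corootv th).
  rewrite aact_r_None /level /= height_sroot; lia.
rewrite /apos e; have := level_neq0 (aact (r None) (a, k)); rewrite e.
move: pb; rewrite /apos; set m := pairing _ _.
have [m0|m0] := leP 0 m; first lia.
have [m1|m1] := eqVneq m (-1); first lia.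
have an : a = neg th.
  rewrite -[a]negK; congr neg; apply/eqP; apply: contraT => /eqP h.
  have := pairing_theta_le1 h; rewrite root_neg pairingNl -/m; lia.
have -> : m = -2.
  by rewrite /m an root_neg pairingNl pairing_root_coroot.
rewrite /level /= an root_neg heightN => h _.
have k1 : k <> 1 by move=> k1; apply: bi; rewrite an k1.
have := pos_theta R; rewrite /pos; move: h; move: (height R _) => u; nia.
Qed.

Lemma word_nil : word [::] = 1%g.
Proof. by rewrite /Defs.word big_nil. Qed.

Lemma word_cons i s : word (i :: s) = (r i * word s)%g.
Proof. by rewrite /Defs.word big_cons. Qed.

Lemma word_cat s t : word (s ++ t) = (word s * word t)%g.
Proof. by rewrite /Defs.word big_cat. Qed.

Lemma word1 i : word [:: i] = r i.
Proof. by rewrite word_cons word_nil mulg1. Qed.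

Lemma word_rcons s i : word (rcons s i) = (word s * r i)%g.
Proof. by rewrite -cats1 word_cat word1. Qed.

Lemma word_rev s : word (rev s) = (word s)^-1%g.
Proof.
elim: s => [|i s IH]; first by rewrite word_nil invg1.
by rewrite rev_cons word_rcons word_cons IH invMg r_V.
Qed.

(** The exchange condition: along the suffixes of s, alpha_i becomes negative
exactly when a letter j meets alpha_j, and that letter can be deleted. *)
Lemma exchange s i : ~~ apos (aact (word s) (sroot_af i)) ->
  exists s1 j s2, s = s1 ++ j :: s2 /\ (word s * r i = word (s1 ++ s2))%g.
Proof.
elim: s => [|j s IH]; first by rewrite word_nil aact1 apos_simple.
rewrite word_cons aactM => h.
have [ps|/IH [s1 [k [s2 [-> e]]]]] := boolP (apos (aact (word s) (sroot_af i))).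
  have [e|/eqP ne] := eqVneq (aact (word s) (sroot_af i)) (sroot_af j); last first.
    by have := apos_r ps ne; rewrite (negbTE h).
  exists [::], j, s; split=> //=.
  by rewrite -mulgA [in X in (_ * X)%g]r_arefl arefl_conj e -r_arefl mulgA r_K mul1g.
by exists (j :: s1), k, s2; rewrite -mulgA e cat_cons word_cons.
Qed.

Definition is_word x := exists s, word s = x.

Lemma is_wordM x y : is_word x -> is_word y -> is_word (x * y)%g.
Proof. by move=> [s <-] [t <-]; exists (s ++ t); rewrite word_cat. Qed.

Lemma is_wordV x : is_word x -> is_word x^-1%g.
Proof. by move=> [s <-]; exists (rev s); rewrite word_rev. Qed.

Definition fin_word s := all isSome s.

Lemma inWM v w : inW (v * w)%g = (inW v * inW w)%g.
Proof. by congr (_, _); rewrite /= act_coweight0 addr0. Qed.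

Lemma inW1 : inW 1%g = 1%g :> Waf R.
Proof. by []. Qed.

Lemma inWV w : inW w^-1%g = (inW w)^-1%g.
Proof. by congr (_, _); rewrite /= act_coweight0 oppr0. Qed.

Lemma fin_wordM v w :
  (exists2 s, fin_word s & word s = inW v) ->
  (exists2 s, fin_word s & word s = inW w) ->
  exists2 s, fin_word s & word s = inW (v * w)%g.
Proof.
move=> [s fs es] [t ft et]; exists (s ++ t); last by rewrite word_cat es et inWM.
by rewrite /fin_word all_cat; apply/andP.
Qed.

Lemma reflection_sroot a c :
  reflection (sroot a c) = (reflection a * reflection c * reflection a)%g.
Proof. by rewrite -act_reflection -reflection_conj reflectionV. Qed.

(** By induction on the positive root: reflections in a root and in its image
under a simple reflection are conjugate. *)
Lemma reflection_word a : exists2 s, fin_word s & word s = inW (reflection a).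
Proof.
have S0 (i : 'I_n) : exists2 s, fin_word s & word s = inW (reflection (simple_root R i)).
  by exists [:: Some i] => //; rewrite word1.
have H c : pos c -> exists2 s, fin_word s & word s = inW (reflection c).
  move: c; apply: pos_root_ind => // i c IH.
  by rewrite reflection_sroot; do 2?[apply: fin_wordM].
have [/H //|h] := boolP (pos a).
by rewrite -reflection_neg; apply: H; rewrite pos_neg.
Qed.

Lemma W_word w : exists2 s, fin_word s & word s = inW w.
Proof.
case: w => p pW; have := pW; case/gen_prodgP => m [c cS ep].
have H (k : nat) (d : 'I_k -> {perm R}) : (forall l, d l \in [set srefl a | a : R]) ->
    exists2 s, fin_word s & exists2 w, word s = inW w & val w = (\prod_l d l)%g.
  elim: k d => [|k IH] d dS.
    exists [::] => //; exists 1%g; first by rewrite word_nil.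
    by rewrite big_ord0.
  have [s fs [w ws wd]] := IH (fun l => d (lift ord0 l)) (fun l => dS _).
  have /imsetP [a _ ea] := dS ord0; have [t ft et] := reflection_word a.
  exists (t ++ s); first by rewrite /fin_word all_cat; apply/andP.
  exists (reflection a * w)%g; first by rewrite word_cat ws et inWM.
  by rewrite big_ord_recl /= wd ea.
have [s fs [w ws wd]] := H m c cS; exists s => //.
by rewrite ws; congr inW; apply: val_inj; rewrite wd.
Qed.

Lemma transl_conj w mu : transl R (act_coweight w mu) = (inW w * transl R mu * (inW w)^-1)%g.
Proof.
rewrite -inWV; congr (_, _); rewrite /= ?mulg1 ?mulgV // act_coweight0 add0r addr0 //.
Qed.

Lemma translD mu nu : transl R (mu + nu) = (transl R mu * transl R nu)%g.
Proof. by congr (_, _); rewrite /= ?mul1g // act_coweight1. Qed.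

Lemma translN mu : transl R (- mu) = (transl R mu)^-1%g.
Proof. by apply: (mulgI (transl R mu)); rewrite mulgV -translD subrr. Qed.

(** Every root pairs non-trivially with a root conjugate to theta, because the
root system is irreducible. *)
Lemma theta_orbit a : exists w, pairing (rootv (act_root w a)) (corootv th) <> 0.
Proof.
pose A := [set a : R | [exists w : W R, pairing (rootv (act_root w a)) (corootv th) != 0]].
suff : A = setT.
  move=> e; have : a \in A by rewrite e inE.
  by rewrite inE => /existsP [w /eqP]; exists w.
have thA : th \in A.
  by rewrite inE; apply/existsP; exists 1%g; rewrite act_root1 pairing_root_coroot.
have orth (c d : R) : c \in A -> d \notin A -> pairing (rootv c) (corootv d) = 0.
  rewrite !inE => /existsP [w wc]; rewrite negb_exists => /forallP dA.
  have dz v : pairing (rootv (act_root v d)) (corootv th) = 0.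
    by have := dA v; rewrite negbK => /eqP.
  apply: coroot_orth_sym; have := dz (w * reflection c)%g.
  rewrite act_rootM act_reflection root_act root_sroot act_weightB act_weightZ.
  rewrite -!root_act pairingBl pairingZl dz sub0r => /eqP.
  by rewrite oppr_eq0 mulf_eq0 (negbTE wc) orbF => /eqP.
by case: (root_irreducible orth) => // e; rewrite e inE in thA.
Qed.

(** The translation by the coroot of theta is r_0 r_theta. Conjugation and the
orbit of theta give the translations by all coroots, which span. *)
Lemma transl_word mu : is_word (transl R mu).
Proof.
have Ww w : is_word (inW w) by have [s _ <-] := W_word w; exists s.
have Cw w nu : is_word (transl R nu) -> is_word (transl R (act_coweight w nu)).
  move=> h; rewrite transl_conj; apply: is_wordM; last exact/is_wordV.
  exact: is_wordM.
have Tth : is_word (transl R (corootv th)).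
  have -> : transl R (corootv th) = (r None * inW (reflection th)^-1)%g.
    by rewrite inWV mulgK.
  by apply: is_wordM => //; exists [:: None]; rewrite word1.
have TN nu : is_word (transl R nu) -> is_word (transl R (- nu)).
  by move=> h; rewrite translN; apply: is_wordV.
(* If <c, theta^v> is 1 or -1, the coroot of c is, up to sign, the difference
   of theta^v and its reflection in c. *)
have T1 a : is_word (transl R (corootv a)).
  have [w] := theta_orbit a; move: (act_root w a) (act_rootK w a) => c <- cth.
  rewrite coroot_act; apply: (Cw w^-1%g).
  have [-> //|/eqP c1] := eqVneq c th.
  have [->|/eqP c2] := eqVneq c (neg th); first by rewrite coroot_neg; apply: TN.
  have h1 := pairing_theta_le1 c1.
  have h2 : -1 <= pairing (rootv c) (corootv th).
    have nc : neg c <> th by move=> e; apply: c2; rewrite -e negK.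
    by have := pairing_theta_le1 nc; rewrite root_neg pairingNl; lia.
  have D : is_word (transl R (pairing (rootv c) (corootv th) *: corootv c)).
    have -> : pairing (rootv c) (corootv th) *: corootv c =
        corootv th - act_coweight (reflection c) (corootv th).
      by rewrite act_coweight_reflection opprB addrC subrK.
    rewrite translD; apply: is_wordM; [exact: Tth | apply: TN; exact: (Cw _ _ Tth)].
  have [e|e] : pairing (rootv c) (corootv th) = 1 \/ pairing (rootv c) (corootv th) = -1 by lia.
    by rewrite e scale1r in D.
  by rewrite e scaleN1r in D; move/TN: D; rewrite opprK.
have Tnat (m : nat) nu : is_word (transl R nu) -> is_word (transl R (m%:Z *: nu)).
  move=> h; elim: m => [|m IH]; first by exists [::]; rewrite scale0r word_nil.
  rewrite intS scalerDl scale1r translD; exact: is_wordM.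
have Tint (k : int) nu : is_word (transl R nu) -> is_word (transl R (k *: nu)).
  move=> h; case: k => m; first exact: Tnat.
  by rewrite NegzE scaleNr; apply/TN/Tnat.
rewrite (row_sum_delta mu); apply: (big_ind (fun nu => is_word (transl R nu))).
- by exists [::]; rewrite word_nil.
- by move=> nu rho h1 h2; rewrite translD; apply: is_wordM.
- by move=> i _; apply: Tint; rewrite -(coroot_simple R i); apply: T1.
Qed.

Lemma all_word x : is_word x.
Proof.
case: x => mu w; have -> : (mu, w) = (transl R mu * inW w)%g.
  by congr (_, _); rewrite /= ?mul1g // act_coweight0 addr0.
apply: is_wordM; first exact: transl_word.
by have [s _ <-] := W_word w; exists s.
Qed.

End AffineRoots.

(** * Length, reduced words and inversions *)

Section Length.
Context (n : nat) (R : simpleRootDatum n).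
Implicit Types (x y : Waf R) (i j : Iaf n) (s t u : seq (Iaf n)).

Local Notation r := (r_ R).
Local Notation word := (@word n R).
Local Notation sr := (sroot_af R).

Lemma redwordP x : word (redword x) = x /\ reduced R (redword x).
Proof.
suff h : exists s, word s = x /\ reduced R s by exact: (epsilon_spec (inhabits [::]) _ h).
have [s es] := all_word x; move: {2}(size s) (leqnn (size s)) => m.
elim: m s es => [|m IH] s es sm.
  by exists s; split=> // t _; move: sm; rewrite leqn0 => /eqP ->.
have [[t [et lt]]|h] := classic (exists t, word t = x /\ (size t < size s)%N).
  by apply: (IH t) => //; rewrite -ltnS; exact: leq_trans lt sm.
exists s; split=> // t et; rewrite leqNgt; apply/negP => lt.
by apply: h; exists t; rewrite et.
Qed.

Lemma word_redword x : word (redword x) = x.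
Proof. by have [] := redwordP x. Qed.

Lemma ell_le s : (ell (word s) <= size s)%N.
Proof. by have [e h] := redwordP (word s); apply: h. Qed.

Definition red s := size s == ell (word s).

Lemma reducedP s : reflect (reduced R s) (red s).
Proof.
apply: (iffP eqP) => [e t et|h]; first by rewrite e -et ell_le.
apply/eqP; rewrite eqn_leq ell_le andbT; apply: h; exact: word_redword.
Qed.

Lemma red_redword x : red (redword x).
Proof. by apply/reducedP; have [] := redwordP x. Qed.

Lemma ell1 : ell (1%g : Waf R) = 0%N.
Proof. by apply/eqP; rewrite -leqn0 -(word_nil R) ell_le. Qed.

Lemma ell_eq0 x : ell x = 0%N -> x = 1%g.
Proof. by move=> /size0nil e; rewrite -(word_redword x) e word_nil. Qed.

Lemma ellV x : ell x^-1%g = ell x.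
Proof.
have le y : (ell y^-1%g <= ell y)%N.
  by rewrite -{1}(word_redword y) -word_rev; apply: leq_trans (ell_le _) _; rewrite size_rev.
by apply/eqP; rewrite eqn_leq le -{1}(invgK x) le.
Qed.

Lemma red_rev s : red (rev s) = red s.
Proof. by rewrite /red word_rev ellV size_rev. Qed.

Lemma ellM x y : (ell (x * y)%g <= ell x + ell y)%N.
Proof.
by rewrite -{1}(word_redword x) -{1}(word_redword y) -word_cat -size_cat ell_le.
Qed.

Lemma red_cat s t : red (s ++ t) -> red s && red t.
Proof.
rewrite /red word_cat size_cat => /eqP e.
have := ellM (word s) (word t); have := ell_le s; have := ell_le t; lia.
Qed.

Lemma red_cons i s : red (i :: s) -> red s.
Proof. by rewrite -cat1s => /red_cat /andP []. Qed.

Lemma red_rcons s i : red (rcons s i) -> red s.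
Proof. by rewrite -cats1 => /red_cat /andP []. Qed.

(** The exchange condition shortens a reduced word of x by one letter. *)
Lemma ell_descent x i :
  ~~ apos (aact x (sr i)) -> ell x = (ell (x * r i)%g).+1.
Proof.
move=> h; have [s1 [j [s2 [e1 e2]]]] : exists s1 j s2,
    redword x = s1 ++ j :: s2 /\ (x * r i = word (s1 ++ s2))%g.
  by have := @exchange _ R (redword x) i; rewrite word_redword; apply.
have l1 : (ell (x * r i)%g < ell x)%N.
  rewrite e2; apply: leq_ltn_trans (ell_le _) _.
  by rewrite [ell x]/ell e1 !size_cat /= addnS ltnS.
have := ellM (x * r i)%g (r i); rewrite -mulgA r_K mulg1.
by have := ell_le [:: i]; rewrite word1 /=; lia.
Qed.

Lemma ell_ascent x i :
  apos (aact x (sr i)) -> ell (x * r i)%g = (ell x).+1.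
Proof.
move=> h; rewrite (@ell_descent (x * r i)%g i) -?mulgA ?r_K ?mulg1 //.
by rewrite aactM aact_r_self aact_neg apos_neg negbK.
Qed.

Lemma red_rconsE s i : red s -> red (rcons s i) = apos (aact (word s) (sr i)).
Proof.
rewrite /red word_rcons size_rcons => /eqP ->.
have [/ell_ascent ->|/ell_descent ->] := boolP (apos _); first by rewrite eqxx.
by apply/negbTE; lia.
Qed.

Lemma red_consE s i : red s -> red (i :: s) = apos (aact (word s)^-1%g (sr i)).
Proof.
move=> h; rewrite -red_rev rev_cons red_rconsE ?red_rev //.
by rewrite word_rev.
Qed.

(** The k-th pair consists of beta_k = s_1 ... s_(k-1) alpha_(s_k) and of s
without its k-th letter, whose value is the reflection in beta_k times the value
of s. *)
Fixpoint deletions s : seq ((R * int) * seq (Iaf n)) :=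
  if s is i :: s' then
    (sr i, s') :: [seq (aact (r i) p.1, i :: p.2) | p <- deletions s']
  else [::].

Definition inversions s := [seq p.1 | p <- deletions s].

Lemma inversions_cons i s :
  inversions (i :: s) = sr i :: map (aact (r i)) (inversions s).
Proof. by rewrite /inversions /= -!map_comp; congr (_ :: _); apply: eq_map. Qed.

Lemma deletionsP s p : p \in deletions s ->
  [/\ word p.2 = (arefl p.1 * word s)%g, size s = (size p.2).+1 & subseq p.2 s].
Proof.
elim: s p => [//|i s IH] p; rewrite /= inE => /orP [/eqP ->|/mapP [q /IH [e1 e2 e3] ->]].
  by split; [rewrite word_cons -r_arefl mulgA r_K mul1g | | exact: subseq_cons].
split; [by rewrite !word_cons e1 !mulgA arefl_conj | by rewrite /= e2 |].
by rewrite /= eqxx.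
Qed.

(** In particular the roots beta_k of a reduced word depend, up to order, only on
its value. *)
Lemma inversionsP s : red s ->
  uniq (inversions s) /\
  forall b, (b \in inversions s) = apos b && ~~ apos (aact (word s)^-1%g b).
Proof.
elim: s => [_|i s IH hr].
  by split=> // b; rewrite word_nil invg1 aact1 andbN.
have hs := red_cons hr; have [us is_] := IH hs.
have pi : apos (aact (word s)^-1%g (sr i)) by rewrite -red_consE.
rewrite inversions_cons /=; split=> [|b].
  rewrite (map_inj_uniq (can_inj (aactK _))) us andbT.
  apply/mapP => -[b]; rewrite is_ => /andP [pb _] e.
  by have := aactK (r i) b; rewrite -e r_V aact_r_self => e'; move: pb; rewrite -e' apos_neg apos_simple.
rewrite inE word_cons invMg aactM r_V.
have [->|/eqP bi] := eqVneq b (sr i).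
  by rewrite apos_simple aact_r_self aact_neg apos_neg pi.
have e c : aact (r i) (aact (r i) c) = c by rewrite -aactM r_K aact1.
rewrite /= -{1}(e b) mem_map ?is_; last by move=> c d h; rewrite -(e c) h e.
apply/andP/andP => -[h1 h2]; split=> //; last exact: apos_r.
by rewrite -(e b); apply: apos_r => // e'; move: h2; rewrite e' pi.
Qed.

End Length.

(** * Skew group rings and divided differences *)

Lemma msupp_pick (G : choiceType) (K V : zmodType) (x : {malg K[G]}) (F : G -> V) h :
  (forall g, x@_g = 0 -> F g = 0) ->
  \sum_(g <- msupp x) F g *+ (g == h) = F h.
Proof.
move=> F0; case: (boolP (h \in msupp x)) => hx.
  rewrite (bigD1_seq h) ?fset_uniq //= eqxx mulr1n big1 ?addr0 // => g /negbTE ->.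
  by rewrite mulr0n.
rewrite F0 ?(mcoeff_outdom hx) // big_seq big1 // => g gx.
by case: eqP => [e|_]; [rewrite -e gx in hx | rewrite mulr0n].
Qed.

Section SkewRingTheory.
Context (G : groupType) (K : comNzRingType) (act : ringAction G K).
Local Notation skew := (skewRing act).
Implicit Types (x y z : skew) (g h : G) (c : K).

Definition skgrp g : skew := << 1 *g g >>.

Lemma skgrpZ c g : c *: skgrp g = << c *g g >>.
Proof. by apply/malgP => k; rewrite mcoeffZ !mcoeffU mulrnAr mulr1. Qed.

Lemma skmulU p q g h :
  (<< p *g g >> : skew) * (<< q *g h >> : skew) = << p * act g q *g (g * h)%g >>.
Proof. exact: skmulUU. Qed.

Lemma skgrp1 : skgrp 1%g = 1.
Proof. by []. Qed.

Lemma skgrpM g h : skgrp (g * h)%g = skgrp g * skgrp h.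
Proof. by rewrite /skgrp skmulU rmorph1 mulr1. Qed.

Lemma skewE x : x = \sum_(g <- msupp x) x@_g *: skgrp g.
Proof. by rewrite {1}[x]monalgE; apply: eq_bigr => g _; rewrite skgrpZ. Qed.

Lemma skgrp_scaleU g c h : skgrp g * (c *: skgrp h) = act g c *: skgrp (g * h)%g.
Proof. by rewrite !skgrpZ /skgrp skmulU mul1r. Qed.

Lemma skscaleAl c x y : c *: (x * y) = (c *: x) * y.
Proof.
rewrite (skewE x) [in RHS]scaler_sumr [in RHS]mulr_suml mulr_suml scaler_sumr.
apply: eq_bigr => g _; rewrite [in LHS](skewE y) [in RHS](skewE y) !mulr_sumr scaler_sumr.
apply: eq_bigr => h _.
by rewrite scalerA !skgrpZ !skmulU -skgrpZ scalerA mulrA skgrpZ.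
Qed.

Lemma skgrp_scale g c x : skgrp g * (c *: x) = act g c *: (skgrp g * x).
Proof.
rewrite (skewE x) scaler_sumr !mulr_sumr scaler_sumr; apply: eq_bigr => h _.
by rewrite scalerA !skgrp_scaleU rmorphM scalerA.
Qed.

Lemma skcoef_grpl g x h : (skgrp g * x)@_h = act g x@_(g^-1 * h)%g.
Proof.
rewrite {1}[x]skewE mulr_sumr raddf_sum /=.
rewrite -(@msupp_pick _ _ _ x (fun k => act g x@_k)) => [|k ->]; last by rewrite rmorph0.
apply: eq_bigr => k _; rewrite skgrp_scaleU mcoeffZ mcoeffU mulrnAr mulr1.
by rewrite (can2_eq (mulKg g) (mulVKg g)).
Qed.

Lemma skcoef_grpr g x h : (x * skgrp g)@_h = x@_(h * g^-1)%g.
Proof.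
rewrite {1}[x]skewE mulr_suml raddf_sum /=.
rewrite -(@msupp_pick _ _ _ x (fun k => x@_k)) //.
apply: eq_bigr => k _; rewrite -skscaleAl -skgrpM mcoeffZ mcoeffU mulrnAr mulr1.
by rewrite (can2_eq (mulgK g) (mulgVK g)).
Qed.

Lemma skcoef_const c x h : (x * (c *: (1 : skew)))@_h = x@_h * act h c.
Proof.
rewrite {1}[x]skewE mulr_suml raddf_sum /=.
rewrite -(@msupp_pick _ _ _ x (fun k => x@_k * act k c)) => [|k ->]; last by rewrite mul0r.
apply: eq_bigr => k _.
by rewrite -skscaleAl skgrp_scale mulr1 !mcoeffZ mcoeffU mulrA mulrnAr mulr1.
Qed.

Lemma skgrp_comm g b c : act g b = b ->
  (c *: (skgrp g - 1)) * (b *: (1 : skew)) = (b *: (1 : skew)) * (c *: (skgrp g - 1)).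
Proof.
move=> gb; rewrite -!skscaleAl mul1r mulrBl mul1r skgrp_scale gb mulr1.
by rewrite -scalerBr !scalerA mulrC.
Qed.

Lemma skconst_mul c x : (c *: (1 : skew)) * x = c *: x.
Proof. by rewrite -skscaleAl mul1r. Qed.

Lemma skgrpB1_mul c g x : (c *: (skgrp g - 1)) * x = c *: (skgrp g * x - x).
Proof. by rewrite -skscaleAl mulrBl mul1r. Qed.

End SkewRingTheory.

Section DividedDifference.
Context (G : groupType) (K : fieldType) (act : ringAction G K).
Local Notation skew := (skewRing act).
Context (g : G) (c : K).
Implicit Types (z : skew) (q : K).

(** A_i in the nilHecke ring, for g = r_i and c = alpha_i. *)
Definition divdiff : skew := c^-1 *: (1 - skgrp act g).

Lemma divdiff_mul z : divdiff * z = c^-1 *: (z - skgrp act g * z).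
Proof. by rewrite /divdiff -skscaleAl mulrBl mul1r. Qed.

Lemma divdiff_coef z h :
  (divdiff * z)@_h = c^-1 * (z@_h - act g z@_(g^-1 * h)%g).
Proof. by rewrite divdiff_mul mcoeffZ mcoeffB skcoef_grpl. Qed.

(** The twisted Leibniz rule. *)
Lemma divdiff_scale q z : divdiff * (q *: z) =
  act g q *: (divdiff * z) + (c^-1 * (q - act g q)) *: z.
Proof.
rewrite !divdiff_mul skgrp_scale; apply/malgP => h.
by rewrite !(mcoeffD, mcoeffB, mcoeffN, mcoeffZ); ring.
Qed.

Lemma divdiff_conj h : (h * h = 1)%g ->
  skgrp act h * divdiff * skgrp act h = (act h c)^-1 *: (1 - skgrp act (h * g * h)%g).
Proof.
move=> hh; rewrite /divdiff skgrp_scale -skscaleAl fmorphV; congr (_ *: _).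
by rewrite mulrBr mulr1 mulrBl -!skgrpM hh skgrp1.
Qed.

Hypothesis c_neq0 : c != 0.

Lemma skgrp_divdiffE : skgrp act g = 1 - c *: divdiff.
Proof. by rewrite /divdiff scalerA divff // scale1r opprB addrC subrK. Qed.

Hypothesis gg : (g * g = 1)%g.

Lemma divdiff_skgrp : divdiff * skgrp act g = - divdiff.
Proof.
by rewrite /divdiff -skscaleAl mulrBl mul1r -skgrpM gg skgrp1 -scalerN opprB.
Qed.

Hypothesis gc : act g c = - c.

Lemma skgrp_divdiff : skgrp act g * divdiff = divdiff.
Proof.
rewrite /divdiff skgrp_scale fmorphV gc invrN mulrBr mulr1 -skgrpM gg skgrp1.
by rewrite scaleNr -scalerN opprB.
Qed.

Lemma divdiff_sqr : divdiff * divdiff = 0.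
Proof. by rewrite divdiff_mul skgrp_divdiff subrr scaler0. Qed.

End DividedDifference.

(** * The nilHecke ring of an abstract level zero representation *)

(** What the argument uses of S = Sym(P) and of its field of fractions: a domain
S containing the weights, embedded in a field K, with compatible actions of the
affine Weyl group for which translations act trivially. *)
Record scalars n (R : simpleRootDatum n) := Scalars {
  fracS :> fieldType;
  intS : idomainType;
  embS : {rmorphism intS -> fracS};
  embS_inj : injective embS;
  actK : ringAction (Waf R) fracS;
  actS : Waf R -> {rmorphism intS -> intS};
  actK_emb : forall x p, actK x (embS p) = embS (actS x p);
  wtS : 'rV[int]_n -> intS;
  wtSB : forall l m, wtS (l - m) = wtS l - wtS m;
  wtSZ : forall k l, wtS (k *: l) = k%:~R * wtS l;
  wtS_inj : injective wtS;
  actS_wt : forall x l, actS x (wtS l) = wtS (act_weight x.2 l);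
  actS_transl : forall mu p, actS (transl R mu) p = p
}.

Section Words.
Context (n : nat) (R : simpleRootDatum n) (K : scalars R).
Local Notation Q := (skewRing (actK K)).
Local Notation S := (intS K).
Implicit Types (a : R) (x y : Waf R) (i j : Iaf n) (s t : seq (Iaf n)) (z : Q).

Local Notation r := (r_ R).
Local Notation word := (@word n R).
Local Notation sr := (sroot_af R).
Local Notation act := (actK K).
Local Notation G := (skgrp (actK K)).
Local Notation i2K := (@embS _ _ K).

Definition wt (l : 'rV[int]_n) : K := i2K (wtS K l).

Lemma wtB l m : wt (l - m) = wt l - wt m.
Proof. by rewrite /wt wtSB rmorphB. Qed.

Lemma wtZ k l : wt (k *: l) = k%:~R * wt l.
Proof. by rewrite /wt wtSZ rmorphM rmorph_int. Qed.

Lemma wtN l : wt (- l) = - wt l.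
Proof. by rewrite -scaleN1r wtZ mulN1r. Qed.

Lemma wt_inj : injective wt.
Proof. by move=> l m /embS_inj /wtS_inj. Qed.

Lemma wt_root_neq0 a : wt (rootv a) != 0.
Proof.
apply/eqP => h; apply: (@root_neq0 _ _ a); apply: wt_inj.
by rewrite h -[X in wt X](scale0r 0) wtZ mul0r.
Qed.

Lemma act_wt x l : act x (wt l) = wt (act_weight x.2 l).
Proof. by rewrite /wt actK_emb actS_wt. Qed.

Lemma alphaE i : alpha R i = rootv (sr i).1.
Proof. by case: i => //=; rewrite root_neg. Qed.

Lemma wt_alpha_neq0 i : wt (alpha R i) != 0.
Proof. by rewrite alphaE wt_root_neq0. Qed.

Lemma act_weight_r i l : act_weight (r i).2 l =
  l - pairing l (corootv (sr i).1) *: rootv (sr i).1.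
Proof. by rewrite r_arefl act_weight_reflection. Qed.

Lemma act_inv_wt x l : act x (wt l)^-1 = (wt (act_weight x.2 l))^-1.
Proof. by rewrite fmorphV act_wt. Qed.

Lemma act_wt_alpha i : act (r i) (wt (alpha R i)) = - wt (alpha R i).
Proof.
rewrite act_wt act_weight_r -alphaE alphaE pairing_root_coroot wtB wtZ.
by rewrite (_ : 2%:~R = 2) //; ring.
Qed.

Definition Asimple i : Q := divdiff (actK K) (r i) (wt (alpha R i)).

Lemma coef_Asimple i z y :
  (Asimple i * z)@_y = (wt (alpha R i))^-1 * (z@_y - act (r i) z@_(r i * y)%g).
Proof. by rewrite divdiff_coef r_V. Qed.

Lemma Asimple_G i : Asimple i * G (r i) = - Asimple i.
Proof. exact: divdiff_skgrp (r_K R i). Qed.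

Lemma G_rE i : G (r i) = 1 - wt (alpha R i) *: Asimple i.
Proof. exact: skgrp_divdiffE (wt_alpha_neq0 i). Qed.

Lemma Asimple_sqr i : Asimple i * Asimple i = 0.
Proof. exact: divdiff_sqr (r_K R i) (act_wt_alpha i). Qed.

Lemma Asimple_scale i (c : K) z : Asimple i * (c *: z) =
  act (r i) c *: (Asimple i * z) + ((wt (alpha R i))^-1 * (c - act (r i) c)) *: z.
Proof. exact: divdiff_scale. Qed.

Definition Aword s : Q := \prod_(i <- s) Asimple i.

Lemma Aword_nil : Aword [::] = 1.
Proof. by rewrite /Aword big_nil. Qed.

Lemma Aword_cons i s : Aword (i :: s) = Asimple i * Aword s.
Proof. by rewrite /Aword big_cons. Qed.

Lemma Aword_cat s t : Aword (s ++ t) = Aword s * Aword t.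
Proof. by rewrite /Aword big_cat. Qed.

Lemma Aword_rcons s i : Aword (rcons s i) = Aword s * Asimple i.
Proof. by rewrite -cats1 Aword_cat Aword_cons Aword_nil mulr1. Qed.

Lemma divdiff_wt i (m : 'rV[int]_n) :
  (wt (alpha R i))^-1 * (wt m - act (r i) (wt m)) = (pairing m (corootv (sr i).1))%:~R.
Proof.
rewrite act_wt act_weight_r wtB wtZ -alphaE subKr.
by rewrite mulrC mulfK // wt_alpha_neq0.
Qed.

Lemma pairing_act_r i (m : 'rV[int]_n) :
  pairing (act_weight (r i).2 m) (corootv (sr i).1) = - pairing m (corootv (sr i).1).
Proof. by rewrite act_weight_r pairingBl pairingZl pairing_root_coroot; lia. Qed.

(** The Chevalley rule: each A_i is a twisted derivation whose value on a weight
is an integer, so moving a weight across A_s deletes at most one letter. *)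
Lemma Aword_wt s (l : 'rV[int]_n) :
  Aword s * (wt l *: (1 : Q)) = wt (act_weight (word s).2 l) *: Aword s
  - \sum_(p <- deletions R s)
      (pairing (act_weight (word s).2 l) (corootv p.1.1))%:~R *: Aword p.2.
Proof.
elim: s => [|i s IH].
  by rewrite Aword_nil mul1r word_nil act_weight1 big_nil subr0.
rewrite Aword_cons -mulrA IH mulrBr Asimple_scale act_wt.
rewrite word_cons /= big_cons big_map /=; set m := act_weight (word s).2 l.
have em : act_weight ((r i).2 * (word s).2)%g l = act_weight (r i).2 m by rewrite act_weightM.
rewrite em -act_wt divdiff_wt pairing_act_r act_wt -addrA mulrNz scaleNr opprD opprK.
congr (_ + (_ - _)); rewrite mulr_sumr; apply: eq_bigr => p _.
rewrite coroot_act pairing_act Asimple_scale rmorph_int subrr mulr0 scale0r addr0.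
by rewrite Aword_cons.
Qed.

Lemma Aword_support s x : (Aword s)@_x != 0 -> exists2 t, subseq t s & word t = x.
Proof.
elim: s x => [|i s IH] x.
  rewrite Aword_nil mcoeffU => h; exists [::] => //; rewrite word_nil; apply/eqP.
  by apply: contraNT h => /negbTE ->; rewrite mulr0n.
rewrite Aword_cons coef_Asimple.
have [h|h _] := eqVneq (Aword s)@_x 0; last first.
  by have [t ts e] := IH _ h; exists t => //; apply: subseq_trans ts (subseq_cons _ _).
have [h'|h' _] := eqVneq (Aword s)@_(r i * x)%g 0; first by rewrite h h' rmorph0 subrr mulr0 eqxx.
have [t ts e] := IH _ h'; exists (i :: t); first by rewrite /= eqxx.
by rewrite word_cons e mulgA r_K mul1g.
Qed.

Lemma Aword_support_ell s x : (Aword s)@_x != 0 -> (ell x <= size s)%N.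
Proof.
by move=> /Aword_support [t ts <-]; apply: leq_trans (ell_le _ _) (size_subseq ts).
Qed.

(** Only the full subword of a reduced word has the same value. *)
Lemma Aword_top s : red R s ->
  (Aword s)@_(word s) = \prod_(b <- inversions R s) - (wt (rootv b.1))^-1.
Proof.
elim: s => [|i s IH] hr; first by rewrite Aword_nil word_nil big_nil mcoeffU eqxx.
rewrite Aword_cons coef_Asimple word_cons mulgA r_K mul1g IH ?(red_cons hr) //.
have -> : (Aword s)@_(r i * word s)%g = 0.
  apply/eqP; apply: contraT => /Aword_support_ell.
  by rewrite -word_cons -(eqP hr) /= ltnn.
rewrite sub0r inversions_cons big_cons alphaE mulNr mulrN; congr (- (_ * _)).
rewrite rmorph_prod big_map; apply: eq_bigr => b _.
by rewrite rmorphN act_inv_wt -root_act.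
Qed.

End Words.

(** * Parabolic subgroups of rank two *)

Section RankTwo.
Context (n : nat) (R : simpleRootDatum n).
Implicit Types (x y : Waf R) (i j : Iaf n) (s t : seq (Iaf n)).

Local Notation r := (r_ R).
Local Notation word := (@word n R).
Local Notation sr := (sroot_af R).
Local Notation th := (theta R).

Lemma fin_word_inW s : fin_word s -> exists w, word s = inW w.
Proof.
elim: s => [_|[i|//] s IH /= /IH [w e]]; first by exists 1%g; rewrite word_nil.
by exists (reflection (simple_root R i) * w)%g; rewrite word_cons e inWM.
Qed.

(** If theta is not simple, it is linearly independent from each simple root,
and the wall of alpha_a meets the affine wall where theta equals 1. *)
Lemma theta_independent a : th <> simple_root R a -> exists p,
  pairing (rootv (simple_root R a)) p = 0 /\ pairing (rootv th) p <> 0.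
Proof.
set c := simple_root R a => thc.
have [/existsP [k /existsP [l kl]]|] := boolP [exists k, exists l,
    rootv c 0 k * rootv th 0 l - rootv c 0 l * rootv th 0 k != 0].
  exists (rootv c 0 k *: delta_mx 0 l - rootv c 0 l *: delta_mx 0 k).
  by rewrite !pairingDr !pairingNr !pairingZr !pairing_delta; split; [ring | apply/eqP].
rewrite negb_exists => /forallP h.
have [k ck] : exists k, rootv c 0 k != 0.
  apply/existsP; rewrite -[X in is_true X]negbK negb_exists; apply/negP => /forallP z.
  apply: (@root_neq0 _ _ c); apply/rowP => k; rewrite mxE.
  by have := z k; rewrite negbK => /eqP.
have e : rootv c 0 k *: rootv th = rootv th 0 k *: rootv c.
  apply/rowP => l; rewrite !mxE; have := h k; rewrite negb_exists => /forallP /(_ l).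
  by rewrite negbK subr_eq0 => /eqP ->; rewrite mulrC.
case: (root_multiple ck e) => // e'.
by have := pos_theta R; rewrite e' pos_neg pos_simple.
Qed.

(** If N = <theta, p> is non-zero, the point p / N lies on both walls, hence is
fixed by the subgroup they generate; multiplying by N keeps the equation
integral. *)
Lemma stabilizer_word a p s : {subset s <= [:: None; Some a]} ->
  pairing (rootv (simple_root R a)) p = 0 ->
  pairing (rootv th) p *: (word s).1 + act_coweight (word s).2 p = p.
Proof.
move=> sub pa; elim: s sub => [_|i s IH sub].
  by rewrite word_nil scaler0 act_coweight1 add0r.
have e := IH (fun j js => sub j (@mem_behead _ (i :: s) j js)).
set N := pairing _ _ in e *.
have g : N *: (r i).1 + act_coweight (r i).2 p = p.
  have := sub i (mem_head _ _); rewrite !inE => /orP [] /eqP ->; rewrite r_arefl /=.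
    rewrite reflection_neg act_coweight_reflection coroot_neg -/N.
    by apply/rowP => k; rewrite !mxE; ring.
  by rewrite act_coweight_reflection pa; apply/rowP => k; rewrite !mxE; ring.
rewrite word_cons -[RHS]g -[X in _ = _ + act_coweight _ X]e /= act_coweightM scalerDr -addrA.
congr (_ + _).
by rewrite act_coweightD act_coweightZ.
Qed.

Lemma rank2_zero a :
  (forall x, apos (aact x (sr None)) || apos (aact x (sr (Some a)))) \/
  (forall s t, {subset s <= [:: None; Some a]} -> {subset t <= [:: None; Some a]} ->
    (word s).2 = (word t).2 -> word s = word t).
Proof.
have [e|/eqP thc] := eqVneq th (simple_root R a); [left=> x | right].
  have: level (aact x (sr None)) + level (aact x (sr (Some a))) = height R (rootv th) + 1.
    rewrite /level /aact /= -e act_root_neg root_neg heightN pairingNl; lia.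
  by have := pos_theta R; rewrite /pos /apos; lia.
have [p [pa pth]] := theta_independent thc.
move=> s t /stabilizer_word /(_ pa) es /stabilizer_word /(_ pa) et e.
have : pairing (rootv th) p *: (word s).1 = pairing (rootv th) p *: (word t).1.
  by apply: (addIr (act_coweight (word s).2 p)); rewrite es e et.
rewrite [word s]surjective_pairing [word t]surjective_pairing e => h; congr (_, _).
apply/rowP => k; move/rowP/(_ k): h; rewrite !mxE; apply: mulfI; exact/eqP.
Qed.

(** A rank-two parabolic subgroup embeds in the finite Weyl group, unless it is
infinite. In that case alpha_i + alpha_j is the constant function 1, which no
element makes negative. *)
Lemma rank2 i j : i != j ->
  (forall x, apos (aact x (sr i)) || apos (aact x (sr j))) \/
  (forall s t, {subset s <= [:: i; j]} -> {subset t <= [:: i; j]} ->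
    (word s).2 = (word t).2 -> word s = word t).
Proof.
have C (k l : Iaf n) s : {subset s <= [:: k; l]} -> {subset s <= [:: l; k]}.
  by move=> h m /h; rewrite !inE orbC.
case: i j => [a|] [b|] // ab.
- right=> s t hs ht; have fin u : {subset u <= [:: Some a; Some b]} -> fin_word u.
    by move=> h; apply/allP => k /h; rewrite !inE => /orP [] /eqP ->.
  have [v ->] := fin_word_inW (fin _ hs); have [w ->] := fin_word_inW (fin _ ht).
  by move=> /= ->.
- case: (rank2_zero a) => h; [left=> x | right=> s t hs ht].
    by rewrite orbC.
  by apply: h; apply: C.
- exact: rank2_zero.
Qed.

(** A minimal representative y of the coset of the parabolic subgroup of i and j:
an exchange of a letter of i or j then takes place in the factor u. *)
Lemma word_J_decomp s i j : red R s -> exists (y u : seq (Iaf n)),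
  [/\ red R (y ++ u), word (y ++ u) = word s, {subset u <= [:: i; j]} &
    forall k, k \in [:: i; j] -> ~~ apos (aact (word s) (sr k)) ->
      exists u', [/\ size u = (size u').+1, (word u * r k)%g = word u' &
        {subset u' <= [:: i; j]}]].
Proof.
move=> rs.
pose P (m : nat) := exists (y u : seq (Iaf n)), [/\ size y = m, red R (y ++ u), word (y ++ u) = word s &
   {subset u <= [:: i; j]}].
have [m [y [u [sy ry ey uJ]]] mmin] : exists2 m, P m & forall m', P m' -> (m <= m')%N.
  have P0 : P (size s) by exists s, [::]; rewrite cats0; split.
  elim/ltn_ind: (size s) P0 => m IH Pm.
  have [[m' [lt /IH h]]|h] := classic (exists m', (m' < m)%N /\ P m'); first exact: h.
  exists m => // m' Pm'; rewrite leqNgt; apply/negP => lt; apply: h; by exists m'.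
exists y, u; split=> // k kJ; rewrite -ey => /exchange [s1 [l [s2 [e1 e2]]]].
have [lt|ge] := ltnP (size s1) (size y).
  (* If the letter were deleted from y, then k could be appended to u and y
   would be shortened, against its minimality. *)
  have ey1 : y = s1 ++ l :: drop (size s1).+1 y.
    rewrite -[LHS](cat_take_drop (size s1)); congr (_ ++ _).
      by have := congr1 (take (size s1)) e1; rewrite take_cat lt take_size_cat.
    have := congr1 (drop (size s1)) e1; rewrite drop_cat lt drop_size_cat //.
    by case e: (drop (size s1) y) (drop_nth l lt) => [|l' y'] // [-> ->] [-> _].
  set y1 := drop _ y in ey1; have es2 : s2 = y1 ++ u.
    by move: e1; rewrite ey1 -catA => /(congr1 (drop (size s1))); rewrite !drop_size_cat // => -[].
  have E : word ((s1 ++ y1) ++ rcons u k) = word s.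
    by rewrite -rcons_cat word_rcons -catA -es2 -e2 -mulgA r_K mulg1 ey.
  have sz : size ((s1 ++ y1) ++ rcons u k) = size (y ++ u).
    by rewrite ey1 !size_cat size_rcons /=; lia.
  have := mmin (size (s1 ++ y1)); rewrite -sy [in size y]ey1 !size_cat /= => h.
  suff : ((size s1 + size y1).+1 <= size s1 + size y1)%N by rewrite ltnn.
  rewrite -addnS; apply: h; exists (s1 ++ y1), (rcons u k); split=> //.
  - by rewrite size_cat.
  - by rewrite /red E -ey sz.
  - by move=> q; rewrite mem_rcons inE => /orP [/eqP -> //|/uJ].
have es1 : s1 = y ++ drop (size y) s1.
  rewrite -[LHS](cat_take_drop (size y)); congr (_ ++ _).
  by have := congr1 (take (size y)) e1; rewrite take_size_cat // takel_cat // => <-.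
set y1 := drop _ s1 in es1.
have eu : u = y1 ++ l :: s2.
  by move: e1; rewrite es1 -catA => /(congr1 (drop (size y))); rewrite !drop_size_cat.
exists (y1 ++ s2); split.
- by rewrite eu !size_cat /= addnS.
- by move: e2; rewrite es1 -catA !word_cat -!mulgA => /mulgI.
- by move=> q; rewrite mem_cat => h; apply: uJ; rewrite eu mem_cat inE orbCA h orbT.
Qed.

End RankTwo.

(** * Independence of the product from the reduced word *)

Section Independence.
Context (n : nat) (R : simpleRootDatum n) (K : scalars R).
Local Notation Q := (skewRing (actK K)).
Implicit Types (x y : Waf R) (i j : Iaf n) (s t u v : seq (Iaf n)) (z : Q).

Local Notation r := (r_ R).
Local Notation word := (@word n R).
Local Notation sr := (sroot_af R).
Local Notation Aword := (Aword K).

(** Comparing coefficients in the field K, only elements whose linear part acts on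
the weights like that of x can occur, and W acts faithfully. *)
Lemma twisted_support (D : Q) x :
  (forall l, D * (wt K l *: (1 : Q)) = wt K (act_weight x.2 l) *: D) ->
  forall y, D@_y != 0 -> y.2 = x.2.
Proof.
move=> h y Dy; apply: act_weight_inj => l; apply: (@wt_inj _ _ K).
rewrite -act_wt; apply: (mulfI Dy).
by rewrite -skcoef_const h mcoeffZ mulrC.
Qed.

Definition indep m := forall s t, (size s <= m)%N -> red R s -> red R t ->
  word s = word t -> Aword s = Aword t.

(** The shortest non-reduced beginning of s ends with a descent of the value of
the letters before it; those have a reduced word ending with the same letter,
whose square A_i A_i vanishes. *)
Lemma Aword_nonred_of m s : indep m -> (size s <= m.+1)%N -> ~~ red R s -> Aword s = 0.
Proof.
move=> Im; elim/last_ind: s => [|t i IH]; first by rewrite /red word_nil ell1.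
rewrite size_rcons ltnS => sm nr.
have [rt|nrt] := boolP (red R t); last by rewrite Aword_rcons IH ?mul0r // (leq_trans sm).
have nd : ~~ apos (aact (word t) (sr i)) by rewrite -red_rconsE.
pose t' := rcons (redword (word t * r i)%g) i.
have wt' : word t' = word t by rewrite word_rcons word_redword -mulgA r_K mulg1.
have rt' : red R t'.
  by rewrite /red wt' size_rcons -/(ell _) -(ell_descent nd).
by rewrite Aword_rcons (Im _ _ sm rt rt') // Aword_rcons -mulrA Asimple_sqr mulr0.
Qed.

(** The value of A_t for a word t of m letters and value x, in terms of x only. *)
Definition Aword_len m x : Q := if ell x == m then Aword (redword x) else 0.

Lemma sum_deletions m v (c : R * int -> K) : indep m -> red R v -> size v = m.+1 ->
  \sum_(p <- deletions R v) c p.1 *: Aword p.2 =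
  \sum_(b <- inversions R v) c b *: Aword_len m (arefl b * word v)%g.
Proof.
move=> Im rv sv.
have -> : \sum_(b <- inversions R v) c b *: Aword_len m (arefl b * word v)%g =
    \sum_(p <- deletions R v) c p.1 *: Aword_len m (arefl p.1 * word v)%g.
  by rewrite /inversions big_map.
apply: eq_big_seq => p /deletionsP [wp sp _]; rewrite -wp /Aword_len.
have sp' : size p.2 = m by move: sp; rewrite sv => -[].
have [rp|np] := boolP (red R p.2).
  rewrite -(eqP rp) sp' eqxx; congr (_ *: _); apply: Im => //; first by rewrite sp'.
    exact: red_redword.
  by rewrite word_redword.
by rewrite -{1}sp' eq_sym -/(red _ _) (negbTE np) (Aword_nonred_of Im) // sp'.
Qed.

Lemma perm_inversions u v : red R u -> red R v -> word u = word v ->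
  perm_eq (inversions R u) (inversions R v).
Proof.
move=> ru rv e; have [uu mu] := inversionsP ru; have [uv mv] := inversionsP rv.
by apply: uniq_perm => // b; rewrite mu mv e.
Qed.

(** The Chevalley rule has the same correction term for two reduced words of
the same element, so the difference of their products intertwines S like that
element, hence is supported on it. But the coefficients there agree. *)
Lemma indep_rank2 m i j u v : indep m -> i != j ->
  {subset u <= [:: i; j]} -> {subset v <= [:: i; j]} ->
  red R u -> red R v -> word u = word v -> size u = m.+1 ->
  ~~ apos (aact (word u) (sr i)) -> ~~ apos (aact (word u) (sr j)) ->
  Aword u = Aword v.
Proof.
move=> Im ij uJ vJ ru rv e su di dj.
have sv : size v = m.+1 by rewrite (eqP rv) -e -(eqP ru).
case: (rank2 R ij) => [/(_ (word u))|inj]; first by rewrite (negbTE di) (negbTE dj).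
have pe := perm_inversions ru rv e.
have tw l : (Aword u - Aword v) * (wt K l *: (1 : Q)) =
    wt K (act_weight (word u).2 l) *: (Aword u - Aword v).
  rewrite mulrBl !Aword_wt -e !(sum_deletions (fun b => (pairing (act_weight (word u).2 l) (corootv b.1))%:~R) Im) //.
  by rewrite -e (perm_big _ pe) /= scalerBr opprB addrA subrK.
apply/eqP; rewrite -subr_eq0; apply/eqP/malgP => y; rewrite mcoeff0; apply/eqP.
apply: contraT => h; have y2 := twisted_support tw h.
have [t tJ ty] : exists2 t, {subset t <= [:: i; j]} & word t = y.
  have [z|/Aword_support [t /mem_subseq ts ey]] := eqVneq (Aword u)@_y 0; last first.
    by exists t => // k /ts /uJ.
  have /Aword_support [t /mem_subseq ts ey] : (Aword v)@_y != 0.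
    by move: h; rewrite mcoeffB z sub0r oppr_eq0.
  by exists t => // k /ts /vJ.
have ey : y = word u by rewrite -ty; apply: inj => //; rewrite ty.
by move: h; rewrite mcoeffB ey {2}e !Aword_top // (perm_big _ pe) subrr eqxx.
Qed.

(** Words with the same last letter are treated by induction. Otherwise both last
letters are descents of the common value, and the two words are replaced by
reduced words with a common beginning y, followed by words in these two letters. *)
Lemma indepP m : indep m.
Proof.
elim: m => [|m Im] s t.
  move=> s0 rs rt e; have := eqP rt; rewrite -e -(eqP rs).
  by case: s t s0 {rs rt e} => [|//] [].
move=> sm rs rt e.
have st : size s = size t by rewrite (eqP rs) e -(eqP rt).
case/lastP: s => [|s1 i] in sm rs e st *; first by case: t st {rt e}.
case/lastP: t => [|t1 j] in rt e st *; first by rewrite size_rcons in st.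
rewrite !size_rcons in sm st; case: st => st.
have rs1 := red_rcons rs; have rt1 := red_rcons rt.
have [ij|ij] := eqVneq i j.
  rewrite -{}ij in rt e *; rewrite !Aword_rcons (Im s1 t1) //.
  by move: e; rewrite !word_rcons => /mulIg.
have di : ~~ apos (aact (word (rcons s1 i)) (sr i)).
  by rewrite word_rcons aactM aact_r_self aact_neg apos_neg negbK -red_rconsE.
have dj : ~~ apos (aact (word (rcons s1 i)) (sr j)).
  by rewrite e word_rcons aactM aact_r_self aact_neg apos_neg negbK -red_rconsE.
have [y [u [ry ey uJ H]]] := word_J_decomp i j rs.
have [ui [si ei uiJ]] := H i (mem_head _ _) di.
have [uj [sj ej ujJ]] : exists u', [/\ size u = (size u').+1, (word u * r j)%g = word u' &
        {subset u' <= [:: i; j]}] by apply: H => //; rewrite !inE eqxx orbT.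
have /andP [_ ru] := red_cat ry.
have su : (size u <= m.+1)%N.
  rewrite -(leq_add2l (size y)) -size_cat (eqP ry) ey -(eqP rs) size_rcons.
  by apply: leq_trans (leq_addl _ _).
have reduct (k : Iaf n) u' p : size u = (size u').+1 -> (word u * r k)%g = word u' ->
    red R (rcons p k) -> (size p <= m)%N -> word (rcons p k) = word (rcons s1 i) ->
    [/\ Aword (rcons p k) = Aword y * Aword (rcons u' k), red R (rcons u' k) & word (rcons u' k) = word u].
  move=> sk ek rp sp ep.
  have wu : word (rcons u' k) = word u by rewrite word_rcons -ek -mulgA r_K mulg1.
  have e1 : word p = word (y ++ u').
    apply: (mulIg (r k)); rewrite -word_rcons ep -ey !word_cat -ek -!mulgA r_K.
    by rewrite mulg1.
  have ryu : red R (y ++ u').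
    apply/eqP; rewrite -e1 -(eqP (red_rcons rp)); apply: succn_inj.
    by rewrite -(size_rcons p k) (eqP rp) ep -ey -(eqP ry) !size_cat sk addnS.
  split=> //; last by rewrite /red wu size_rcons -sk (eqP ru).
  by rewrite !Aword_rcons mulrA (Im p (y ++ u')) ?(red_rcons rp) // Aword_cat.
have [-> ri wi] := reduct i ui s1 si ei rs sm erefl.
have tm : (size t1 <= m)%N by rewrite -st.
have [-> rj wj] := reduct j uj t1 sj ej rt tm (esym e).
congr (_ * _); move: su; rewrite si ltnS => sim.
have Ik : indep (size ui) by move=> s' t' h; apply: Im; exact: leq_trans sim.
apply: (indep_rank2 Ik ij) => //; rewrite ?wi ?wj ?size_rcons //.
- by move=> k; rewrite mem_rcons inE => /orP [/eqP -> |/uiJ //]; rewrite inE eqxx.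
- by move=> k; rewrite mem_rcons inE => /orP [/eqP -> |/ujJ //]; rewrite !inE eqxx orbT.
- by rewrite -wi word_rcons aactM aact_r_self aact_neg apos_neg negbK -red_rconsE ?(red_rcons ri).
- by rewrite -wj word_rcons aactM aact_r_self aact_neg apos_neg negbK -red_rconsE ?(red_rcons rj).
Qed.

(** The product A_s vanishes unless s is reduced, and then depends only on its
value: the A_i satisfy the braid relations. *)
Definition Aelt x : Q := Aword (redword x).

Lemma Aword_red s : red R s -> Aword s = Aelt (word s).
Proof.
move=> rs; apply: (@indepP (size s)) => //; first exact: red_redword.
by rewrite word_redword.
Qed.

Lemma Aword_nonred s : ~~ red R s -> Aword s = 0.
Proof. by apply: (@Aword_nonred_of (size s)); [exact: indepP | exact: leqnSn]. Qed.

End Independence.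

(** * The A_x as a basis *)

HB.lock Definition mono n (R : simpleRootDatum n) (K : scalars R) (p : intS K)
  (x : Waf R) : {malg (intS K)[Waf R]} := << p *g x >>.

Arguments mono {n R K}.

Section SchubertBasis.
Context (n : nat) (R : simpleRootDatum n) (K : scalars R).
Local Notation Q := (skewRing (actK K)).
Local Notation S := (intS K).
Implicit Types (a : R) (x y : Waf R) (i j : Iaf n) (s t : seq (Iaf n)) (z : Q) (p : S).

Local Notation r := (r_ R).
Local Notation word := (@word n R).
Local Notation sr := (sroot_af R).
Local Notation act := (actK K).
Local Notation G := (skgrp (actK K)).
Local Notation emb := (@embS _ _ K).
Local Notation Aword := (Aword K).
Local Notation Aelt := (Aelt K).
Local Notation wt := (wt K).

Lemma mono_coef p x y : (mono p x)@_y = p *+ (x == y).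
Proof. by rewrite mono.unlock mcoeffU. Qed.

Definition Alin (c : {malg S[Waf R]}) : Q :=
  \sum_(x <- msupp c) emb c@_x *: Aelt x.

Lemma Alinw (d : {fset Waf R}) c : (msupp c `<=` d)%fset ->
  Alin c = \sum_(x <- d) emb c@_x *: Aelt x.
Proof.
move=> h; rewrite /Alin; apply: big_fset_incl => // x _ /mcoeff_outdom ->.
by rewrite rmorph0 scale0r.
Qed.

Lemma AlinD c d : Alin (c + d) = Alin c + Alin d.
Proof.
rewrite (Alinw (msuppD_le c d)) (Alinw (fsubsetUl (msupp c) (msupp d))).
rewrite (Alinw (fsubsetUr (msupp c) (msupp d))) -big_split /=.
by apply: eq_bigr => x _; rewrite mcoeffD rmorphD scalerDl.
Qed.

Lemma Alin0 : Alin 0 = 0.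
Proof. by rewrite /Alin msupp0 big_seq_fset0. Qed.

Lemma AlinU p x : Alin (mono p x) = emb p *: Aelt x.
Proof. by rewrite mono.unlock (Alinw msuppU_le) big_seq_fset1 mcoeffUU. Qed.

Lemma AlinZ p c : Alin (p *: c) = emb p *: Alin c.
Proof.
rewrite (Alinw (msuppZ_le p c)) /Alin scaler_sumr.
by apply: eq_bigr => x _; rewrite mcoeffZ rmorphM scalerA.
Qed.

Lemma Alin_sum I (u : seq I) (P : pred I) F :
  Alin (\sum_(k <- u | P k) F k) = \sum_(k <- u | P k) Alin (F k).
Proof. exact: (big_morph Alin AlinD Alin0). Qed.

Lemma Aelt_coef x y : (ell y <= ell x)%N -> (Aelt y)@_x != 0 -> y = x.
Proof.
move=> le /Aword_support [t ts e].
have sz : size t = size (redword y).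
  apply/eqP; rewrite eqn_leq size_subseq // (leq_trans le) //.
  by rewrite -e ell_le.
have := (size_subseq_leqif ts).2; rewrite sz eqxx => /esym/eqP et.
by rewrite -e et word_redword.
Qed.

Lemma Aelt_top_neq0 x : (Aelt x)@_x != 0.
Proof.
have -> : (Aelt x)@_x = (Aword (redword x))@_(word (redword x)) by rewrite word_redword.
rewrite Aword_top ?red_redword //.
by rewrite prodf_seq_neq0; apply/allP => b _ /=; rewrite oppr_eq0 invr_eq0 wt_root_neq0.
Qed.

(** The A_x are triangular with respect to the group elements, graded by
length, with non-zero diagonal. *)
Lemma Alin_eq0 c : Alin c = 0 -> c = 0.
Proof.
move=> h; apply/malgP => k; rewrite mcoeff0; apply: mcoeff_outdom.
suff -> : msupp c = fset0 by rewrite in_fset0.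
apply/eqP; apply: contraT => /fset0Pn [x0 hx0] {k}.
pose m := \max_(x <- msupp c) ell x.
have [x xc em] : exists2 x, x \in msupp c & forall y, y \in msupp c -> (ell y <= ell x)%N.
  have ex : exists k, has (fun x => k == ell x) (msupp c).
    by exists (ell x0); apply/hasP; exists x0.
  have ub k : has (fun x => k == ell x) (msupp c) -> (k <= m)%N.
    by move=> /hasP [x xc /eqP ->]; rewrite /m (big_rem x) //= leq_maxl.
  case: (ex_maxnP ex ub) => k /hasP [x xc /eqP ->] mx; exists x => // y yc.
  by apply: mx; apply/hasP; exists y.
have := congr1 (monalg.mcoeff x) h; rewrite mcoeff0 /Alin raddf_sum /=.
rewrite (bigD1_seq x) ?fset_uniq //= big_seq_cond big1 ?addr0; last first.
  move=> y /andP [yc yx]; rewrite mcoeffZ.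
  have [->|/(Aelt_coef (em y yc)) e] := eqVneq (Aelt y)@_x 0; first by rewrite mulr0.
  by rewrite e eqxx in yx.
rewrite mcoeffZ => /eqP; rewrite mulf_eq0 (negbTE (Aelt_top_neq0 x)) orbF.
rewrite -(rmorph0 emb) (inj_eq (@embS_inj _ _ K)) => z.
by move: xc; rewrite -mcoeff_neq0 z.
Qed.

Lemma Alin_inj : injective Alin.
Proof.
move=> c d h; apply/eqP; rewrite -subr_eq0; apply/eqP/Alin_eq0.
by rewrite AlinD h -AlinD subrr Alin0.
Qed.

(** The sign twist relating xi^v(w) to the coefficient of A_v in w. *)
Definition twist (c : {malg S[Waf R]}) : {malg S[Waf R]} :=
  \sum_(v <- msupp c) mono ((-1) ^+ ell v * c@_v) v.

Lemma twist_coef c v : (twist c)@_v = (-1) ^+ ell v * c@_v.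
Proof.
rewrite raddf_sum /=; under eq_bigr => x _ do rewrite mono_coef.
by rewrite (@msupp_pick _ _ _ c (fun x => (-1) ^+ ell x * c@_x)) // => x ->; rewrite mulr0.
Qed.

Lemma Alin_twist c :
  Alin (twist c) = \sum_(v <- msupp c) emb ((-1) ^+ ell v * c@_v) *: Aelt v.
Proof. by rewrite Alin_sum; apply: eq_bigr => v _; rewrite AlinU. Qed.

Lemma twistK c : twist (twist c) = c.
Proof.
apply/malgP => v; rewrite !twist_coef mulrA -exprD addnn -mul2n exprM sqrrN.
by rewrite !expr1n mul1r.
Qed.

Lemma untwist_coef c v : c@_v = (-1) ^+ ell v * (twist c)@_v.
Proof. by rewrite -twist_coef twistK. Qed.

Lemma Alin_untwist c :
  Alin c = \sum_(v <- msupp (twist c)) emb ((-1) ^+ ell v * (twist c)@_v) *: Aelt v.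
Proof. by rewrite -Alin_twist twistK. Qed.

(** Linear combinations of the products A_s over all words, reduced or not:
they are closed under concatenation of words, which the A_x are not. *)
Definition comb (L : seq (S * seq (Iaf n))) : Q :=
  \sum_(q <- L) emb q.1 *: Aword q.2.

Lemma comb_cat L M : comb (L ++ M) = comb L + comb M.
Proof. by rewrite /comb big_cat. Qed.

Definition collect (L : seq (S * seq (Iaf n))) : {malg S[Waf R]} :=
  \sum_(q <- L | red R q.2) mono (q.1) (word q.2).

Lemma comb_collect L : comb L = Alin (collect L).
Proof.
rewrite Alin_sum /comb [RHS]big_mkcond; apply: eq_bigr => q _.
case: ifP => [h|/negbT /Aword_nonred ->]; last by rewrite scaler0.
by rewrite AlinU Aword_red.
Qed.

Lemma collect_coef L x :
  (collect L)@_x = \sum_(q <- L | red R q.2 && (word q.2 == x)) q.1.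
Proof.
rewrite /collect raddf_sum /= big_mkcondr; apply: eq_bigr => q _.
by rewrite mono_coef; case: eqP.
Qed.

Definition span z := exists L, z = comb L.

Lemma spanD z z' : span z -> span z' -> span (z + z').
Proof. by move=> [L ->] [M ->]; exists (L ++ M); rewrite /comb big_cat. Qed.

Lemma spanZ p z : span z -> span (emb p *: z).
Proof.
move=> [L ->]; exists [seq (p * q.1, q.2) | q <- L].
by rewrite /comb big_map scaler_sumr; apply: eq_bigr => q _; rewrite rmorphM scalerA.
Qed.

Lemma spanB z z' : span z -> span z' -> span (z - z').
Proof.
move=> h h'; apply: spanD => //; rewrite -scaleN1r -(rmorph1 emb) -rmorphN.
exact: spanZ.
Qed.

Lemma span_Aword s : span (Aword s).
Proof. by exists [:: (1, s)]; rewrite /comb big_seq1 rmorph1 scale1r. Qed.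

Lemma span_sum I (u : seq I) F : (forall k, span (F k)) -> span (\sum_(k <- u) F k).
Proof.
move=> h; elim: u => [|k u IH]; first by exists [::]; rewrite /comb !big_nil.
by rewrite big_cons; apply: spanD.
Qed.

(** Closure under right multiplication can be tested on the A_s, since scalars
stand on the left. *)
Lemma span_mulr z z' : (forall s, span (Aword s * z')) -> span z -> span (z * z').
Proof.
move=> h [L ->]; rewrite /comb mulr_suml; apply: span_sum => q.
by rewrite -skscaleAl; apply: spanZ.
Qed.

Lemma span_mull z i : span z -> span (G (r i) * z).
Proof.
move=> [L ->]; rewrite /comb mulr_sumr; apply: span_sum => q.
rewrite skgrp_scale actK_emb; apply: spanZ; rewrite G_rE mulrBl mul1r.
apply: spanB; first exact: span_Aword.
by rewrite -skscaleAl -Aword_cons; apply: spanZ; apply: span_Aword.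
Qed.

Lemma span_mul_wt z (l : 'rV[int]_n) : span z -> span (z * (wt l *: (1 : Q))).
Proof.
apply: span_mulr => s; rewrite Aword_wt; apply: spanB; first by apply: spanZ; apply: span_Aword.
by apply: span_sum => q; rewrite -(rmorph_int emb); apply: spanZ; apply: span_Aword.
Qed.

Lemma span_mul_grp z i : span z -> span (z * G (r i)).
Proof.
apply: span_mulr => s; rewrite G_rE mulrBr mulr1; apply: spanB; first exact: span_Aword.
have -> : Aword s * (wt (alpha R i) *: Asimple K i) = Aword s * (wt (alpha R i) *: (1 : Q)) * Asimple K i.
  by rewrite -mulrA -skscaleAl mul1r.
apply: span_mulr; last by apply: span_mul_wt; apply: span_Aword.
by move=> t; rewrite -Aword_rcons; apply: span_Aword.
Qed.

(** The reflection in a root a is conjugate to a simple one, so that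
(1 - r_a) / a is conjugate to some A_i and stays in the S-span. *)
Lemma span_reflection a : pos a ->
  span (divdiff act (inW (reflection a)) (wt (rootv a))).
Proof.
move: a; apply: pos_root_ind => [i|i a h].
  by have := span_Aword [:: Some i]; rewrite Aword_cons Aword_nil mulr1.
have := span_mul_grp (Some i) (span_mull (Some i) h).
rewrite divdiff_conj; last exact: r_K.
by rewrite act_wt -root_act /= act_reflection reflection_sroot !inWM.
Qed.

(** Multiplying out the factors r_i = 1 - alpha_i A_i of a word t of value y, with
scalars moved to the left. The expansion of y^-1 follows the same steps on the
right: if A_s has coefficient c in y, its reverse has coefficient
(-1)^|s| y^-1(c) in y^-1. This is the symmetry of the xi, free of any choice of
reduced words. *)
Lemma expansion t : exists L : seq (S * seq (Iaf n)),
  [/\ comb L = G (word t),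
      comb [seq ((-1) ^+ size q.2 * actS K (word t)^-1%g q.1, rev q.2) | q <- L]
        = G (word t)^-1%g,
      \sum_(q <- L | q.2 == [::]) q.1 = 1 &
      fin_word t -> all (fun q => fin_word q.2) L].
Proof.
elim: t => [|i t [L [e1 e2 e3 e4]]].
  exists [:: (1, [::])]; split=> //.
  - by rewrite word_nil skgrp1 /comb big_seq1 rmorph1 scale1r Aword_nil.
  - rewrite word_nil invg1 skgrp1 /comb big_seq1 /= expr0 rmorph1 mulr1.
    by rewrite rmorph1 scale1r Aword_nil.
  - by rewrite big_cons big_nil eqxx addr0.
exists ([seq (actS K (r i) q.1, q.2) | q <- L] ++
        [seq (- (wtS K (alpha R i) * actS K (r i) q.1), i :: q.2) | q <- L]).
have wV (k : S) : actS K (word (i :: t))^-1%g k = actS K (word t)^-1%g (actS K (r i) k).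
  by apply: (@embS_inj _ _ K); rewrite -!actK_emb word_cons invMg r_V ractM.
have aK (k : S) : actS K (r i) (actS K (r i) k) = k.
  by apply: (@embS_inj _ _ K); rewrite -!actK_emb -ractM r_K ract1.
have ra : actS K (r i) (wtS K (alpha R i)) = - wtS K (alpha R i).
  by apply: (@embS_inj _ _ K); rewrite -actK_emb rmorphN; apply: act_wt_alpha.
have wV' k : actS K (word (i :: t))^-1%g (- (wtS K (alpha R i) * actS K (r i) k)) =
    actS K (word t)^-1%g (wtS K (alpha R i)) * actS K (word t)^-1%g k.
  by rewrite wV -rmorphM; congr (actS K _ _); rewrite rmorphN rmorphM ra aK mulNr opprK.
split.
- rewrite word_cons skgrpM -e1 /comb big_cat !big_map /= -big_split mulr_sumr.
  apply: eq_bigr => q _; rewrite skgrp_scale actK_emb G_rE mulrBl mul1r scalerBr.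
  rewrite -skscaleAl -Aword_cons; congr (_ + _).
  by rewrite rmorphN rmorphM scaleNr scalerA mulrC.
- rewrite map_cat comb_cat -!map_comp.
  rewrite (_ : comb _ = G (word t)^-1%g); last first.
    by rewrite -e2; congr comb; apply: eq_map => q /=; rewrite wV aK.
  rewrite [in RHS]word_cons invMg skgrpM r_V G_rE mulrBr mulr1 skgrp_scale.
  congr (_ + _); rewrite -e2 /comb !big_map /= mulr_suml scaler_sumr -sumrN.
  apply: eq_bigr => q _; rewrite wV' rev_cons Aword_rcons.
  rewrite -skscaleAl scalerA -scaleNr actK_emb -(rmorphM emb) -(rmorphN emb).
  by rewrite exprS mulN1r mulNr mulrCA.
- rewrite big_cat !big_map /= [X in _ + X]big1 // addr0.
  by rewrite -rmorph_sum /= e3 rmorph1.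
- move=> /= /andP [fi /e4 h]; rewrite all_cat !all_map; apply/andP; split=> //.
  by apply: sub_all h => q /= h; rewrite fi.
Qed.

End SchubertBasis.

(** * Minimal coset representatives *)

Section MinimalRepresentatives.
Context (n : nat) (R : simpleRootDatum n).
Implicit Types (x y : Waf R) (w : W R).

Local Notation sr := (sroot_af R).
Local Notation th := (theta R).
Local Notation r0 := (r_ R None).

Lemma inW_inj : injective (@inW n R).
Proof. by move=> v w []. Qed.

Lemma transl_inW x : x = (transl R x.1 * inW x.2)%g.
Proof.
rewrite [LHS]surjective_pairing.
by congr (_, _); rewrite /= ?mul1g // act_coweight0 addr0.
Qed.

(** Positivity is additive, so an element that keeps the simple roots of the
finite system positive keeps all its positive roots positive. *)
Lemma apos_fin x a : (forall i, apos (aact x (sr (Some i)))) -> pos a ->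
  apos (aact x (a, 0)).
Proof.
move=> h pa.
pose f (l : 'rV[int]_n) := height R (act_weight x.2 l)
  - (height R (rootv th) + 1) * pairing (act_weight x.2 l) x.1.
have fE b : level (aact x (b, 0)) = f (rootv b).
  by rewrite /level /aact /f /= root_act; ring.
have fD l m : f (l + m) = f l + f m.
  by rewrite /f act_weightD heightD pairingDl; ring.
have fZ k l : f (k *: l) = k * f l.
  by rewrite /f act_weightZ heightZ pairingZl; ring.
have f0 : f 0 = 0 by rewrite -(scale0r 0) fZ mul0r.
have : 0 <= f (scale R *: rootv a).
  rewrite scale_root (big_morph f fD f0); apply: sumr_ge0 => i _.
  rewrite fZ mulr_ge0 //; last by rewrite -fE ltW //; apply: h.
  by case: (root_signs a) => [] [g] //; move: pa; rewrite /pos; lia.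
rewrite fZ -fE pmulr_rge0 ?scale_gt0 // => ge; rewrite /apos lt_def ge andbT.
exact: level_neq0.
Qed.

(** The last letter of s is a descent of the word before it, which can therefore
be shortened: the value of s also has a word with two letters fewer. *)
Lemma fin_positive s : fin_word s ->
  (forall i, apos (aact (word R s) (sr (Some i)))) -> word R s = 1%g.
Proof.
move: {2}(size s) (leqnn (size s)) => m; elim: m s => [|m IH] s.
  by rewrite leqn0 => /nilP ->; rewrite word_nil.
case/lastP: s => [|s k]; first by rewrite word_nil.
rewrite size_rcons ltnS /fin_word all_rcons => sm /andP [].
case: k => [k|//] _ fs h.
have nk : ~~ apos (aact (word R s) (sr (Some k))).
  by have := h k; rewrite word_rcons aactM aact_r_self aact_neg apos_neg.
have [s1 [j [s2 [es ew]]]] := exchange nk.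
have sz : (size (s1 ++ s2) <= m)%N.
  by apply: leq_trans sm; rewrite es !size_cat /= leq_add2l.
rewrite word_rcons ew; apply: IH => // [|i].
  by move: fs; rewrite es /fin_word !all_cat /= => /and3P [-> _ ->].
by rewrite -ew -word_rcons.
Qed.

(** A shortest element x w of x W keeps the simple roots of W positive. If w sent
one of them to a negative root, then so would x w, since x keeps the positive
roots of W positive. So w keeps all simple roots positive, and w = 1. *)
Lemma Waf0_positive x : (forall i, apos (aact x (sr (Some i)))) -> Waf0 x.
Proof.
move=> h; pose f w := ell (x * inW w)%g.
have [w0 _ wmin] := @arg_minnP _ (1%g : W R) xpredT f isT.
suff w01 : w0 = 1%g.
  by move=> w; have := wmin w isT; rewrite /f w01 inW1 mulg1.
apply: inW_inj; have [s fs es] := W_word w0; rewrite -es.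
apply: fin_positive => // i; rewrite es; apply: contraT.
rewrite /aact /= => ni.
have e0 : (act_root w0 (simple_root R i), 0) = aact (inW w0) (sr (Some i)).
  rewrite /aact /=; congr (_, _).
  by rewrite /pairing big1 ?subr0 // => k _; rewrite mxE mulr0.
move: ni; rewrite -[X in apos X]/(aact (inW w0) (sr (Some i))) -e0 => ni.
have ny : ~~ apos (aact (x * inW w0)%g (sr (Some i))).
  rewrite aactM -e0 -[(act_root _ _, _)]anegK aact_neg apos_neg negbK /aneg /= oppr0.
  apply: apos_fin => //; rewrite pos_neg; move: ni.
  by rewrite /apos /level /= mulr0 addr0.
have := ell_descent ny.
have := wmin (w0 * reflection (simple_root R i))%g isT.
by rewrite /f inWM mulgA => le e; move: le; rewrite e ltnn.
Qed.

Lemma not_Waf0 x : ~ Waf0 x -> exists i, ~~ apos (aact x (sr (Some i))).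
Proof.
move=> h; apply/existsP; rewrite -[X in is_true X]negbK negb_exists; apply/negP.
by move=> /forallP p; apply/h/Waf0_positive => i; have := p i; rewrite negbK.
Qed.

(** The inverse of a finite element sends alpha_0 = 1 - theta to 1 minus a root. *)
Lemma red_r0 w : red R (None :: redword (inW w)).
Proof.
rewrite red_consE ?red_redword // word_redword -inWV /apos /level /aact /=.
rewrite [pairing _ _]big1 => [|k _]; last by rewrite mxE mulr0.
by rewrite act_root_neg root_neg heightN; have := height_theta (act_root w^-1 th); lia.
Qed.

Lemma ell_r0 w : ell (r0 * inW w)%g = (ell (inW w)).+1.
Proof. by have := eqP (red_r0 w); rewrite word_cons word_redword => <-. Qed.

Lemma Waf0_inW w : Waf0 (inW w) -> w = 1%g.
Proof.
move=> /(_ w^-1%g); rewrite inWV mulgV ell1 leqn0 => /eqP /ell_eq0 e.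
exact: inW_inj.
Qed.

Lemma Waf0_r0 w : Waf0 (r0 * inW w)%g -> w = 1%g.
Proof.
move=> /(_ w^-1%g); rewrite inWV mulgK ell_r0 -(mulg1 r0) -inW1 ell_r0.
rewrite inW1 ell1 ltnS leqn0 => /eqP /ell_eq0 e; exact: inW_inj.
Qed.

Lemma r0_neq_inW w : r0 <> inW w.
Proof.
move=> /(congr1 fst) /=; rewrite act_coweight0 addr0 => h.
by have := pairing_root_coroot th; rewrite h /pairing big1 // => k _; rewrite mxE mulr0.
Qed.

End MinimalRepresentatives.

(** * The expansion of the reflection in theta *)

Section Theta.
Context (n : nat) (R : simpleRootDatum n) (K : scalars R).
Local Notation Q := (skewRing (actK K)).
Local Notation S := (intS K).
Implicit Types (x y : Waf R) (w : W R) (z : Q).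

Local Notation r := (r_ R).
Local Notation sr := (sroot_af R).
Local Notation act := (actK K).
Local Notation G := (skgrp (actK K)).
Local Notation emb := (@embS _ _ K).
Local Notation Aword := (Aword K).
Local Notation Aelt := (Aelt K).
Local Notation wt := (wt K).
Local Notation th := (theta R).
Local Notation rt := (inW (reflection th)).
Local Notation r0 := (r None).

Lemma Aelt1 : Aelt 1%g = 1.
Proof. by rewrite -(word_nil R) -Aword_red ?Aword_nil // /red word_nil ell1. Qed.

Lemma Alin_fin (c : {malg S[Waf R]}) : (forall x, c@_x != 0 -> exists w, x = inW w) ->
  Alin c = \sum_(w : W R) emb c@_(inW w) *: Aelt (inW w).
Proof.
move=> h; have {1}-> : c = \sum_(w : W R) mono (c@_(inW w)) (inW w).
  apply/malgP => x; rewrite raddf_sum /=.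
  under eq_bigr => w _ do rewrite mono_coef.
  have [z|/h [w0 ->]] := eqVneq c@_x 0.
    rewrite z big1 // => w _; case: eqP => [e|_]; last by rewrite mulr0n.
    by rewrite e z mul0rn.
  rewrite (bigD1 w0) //= eqxx mulr1n big1 ?addr0 // => w wn.
  by rewrite (inj_eq (@inW_inj _ _)) (negbTE wn) mulr0n.
by rewrite Alin_sum; apply: eq_bigr => w _; rewrite AlinU.
Qed.

Lemma rtV : rt^-1%g = rt.
Proof. by rewrite -inWV reflectionV. Qed.

(** The coefficients of r_theta away from the identity are divisible by theta,
since (1 - r_theta) / theta lies in the S-span of the A_x. The last equation is
the symmetry w^-1 xi^v(w) = (-1)^l(v) xi^(v^-1)(w^-1) for the involution
w = r_theta. *)
Lemma theta_expansion : exists d : {malg S[Waf R]},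
  [/\ G rt = Alin d, d@_1%g = 1,
    forall x, x <> 1%g -> exists s, d@_x = wtS K (rootv th) * s &
    G rt = \sum_(w : W R)
      emb (actS K rt ((-1) ^+ ell (inW w) * d@_((inW w)^-1)%g)) *: Aelt (inW w)].
Proof.
have [t ft et] := W_word (reflection th).
have [L [e1 e2 e3 e4]] := expansion K t; rewrite et rtV in e1 e2.
have fL q : q \in L -> fin_word q.2 by move=> qL; exact: (allP (e4 ft)).
exists (collect L); split.
- by rewrite -e1 comb_collect.
- rewrite collect_coef -[RHS]e3; apply: eq_bigl => q.
  apply/andP/eqP => [[rq /eqP e]| ->]; last by rewrite /red word_nil ell1.
  by apply: size0nil; rewrite (eqP rq) e ell1.
- have [M eM] := span_reflection K (pos_theta R).
  have -> : collect L = mono 1 1%g - wtS K (rootv th) *: collect M.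
    apply: Alin_inj; rewrite -comb_collect e1.
    rewrite -scaleN1r scalerA AlinD AlinZ AlinU Aelt1 rmorph1 scale1r.
    rewrite -comb_collect -eM rmorphM rmorphN1 mulN1r scaleNr scalerA.
    by rewrite divff ?wt_root_neq0 // scale1r opprB addrC subrK.
  move=> x /eqP x1; exists (- (collect M)@_x).
  by rewrite mcoeffB mcoeffZ mono_coef eq_sym (negbTE x1) mulr0n sub0r mulrN.
- set M := [seq _ | q <- L] in e2.
  have cE w : (collect M)@_(inW w) =
      actS K rt ((-1) ^+ ell (inW w) * (collect L)@_(inW w)^-1%g).
    rewrite rmorphM rmorphXn rmorphN1 !collect_coef rmorph_sum mulr_sumr /M big_map.
    rewrite (eq_bigl (fun q => red R q.2 && (word R q.2 == (inW w)^-1%g))); last first.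
      by move=> q /=; rewrite red_rev word_rev -(inj_eq invg_inj) invgK.
    apply: eq_bigr => q /andP [rq /eqP e].
    by rewrite (eqP rq) e ellV.
  rewrite -[LHS]e2 comb_collect Alin_fin => [|x].
    by apply: eq_bigr => w _; rewrite cE.
  rewrite collect_coef /M big_map => h.
  have [q qL [rq /eqP e]] : exists2 q, q \in L & red R (rev q.2) /\ word R (rev q.2) == x.
    apply: NNPP => no; move: h; rewrite big_seq_cond big1 ?eqxx // => q.
    by move=> /and3P [qL rq e]; case: no; exists q => //; split.
  have fq : fin_word (rev q.2) by rewrite /fin_word all_rev; apply: fL.
  by have [w] := fin_word_inW R fq; exists w; rewrite -e.
Qed.

Lemma theta_xi : exists d : {malg S[Waf R]}, G rt = Alin d /\
  forall xi : Waf R -> S, (forall v, xi v = (-1) ^+ ell v * d@_v) ->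
  [/\ xi 1%g = 1, forall x, x <> 1%g -> exists s, xi x^-1%g = wtS K (rootv th) * s &
    G rt = \sum_w emb (actS K rt (xi (inW w)^-1%g)) *: Aelt (inW w)].
Proof.
have [d [e d1 ddiv eV]] := theta_expansion; exists d; split; [exact: e | move=> xi xid; split].
- by rewrite xid ell1 d1 mulr1.
- move=> x x1; have x1' : x^-1%g <> 1%g by move=> h; apply: x1; rewrite -(invgK x) h invg1.
  by have [s e'] := ddiv _ x1'; exists ((-1) ^+ ell x^-1%g * s); rewrite xid e' mulrCA.
- have k w : xi (inW w)^-1%g = (-1) ^+ ell (inW w) * d@_(inW w)^-1%g by rewrite xid ellV.
  by apply: etrans eV _; apply: eq_bigr => w _; rewrite k.
Qed.

End Theta.

(** * The Peterson element of r_0 *)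

Section PetersonElement.
Context (n : nat) (R : simpleRootDatum n) (K : scalars R).
Local Notation Q := (skewRing (actK K)).
Local Notation S := (intS K).
Implicit Types (x y : Waf R) (w : W R) (z : Q).

Local Notation r := (r_ R).
Local Notation sr := (sroot_af R).
Local Notation act := (actK K).
Local Notation G := (skgrp (actK K)).
Local Notation emb := (@embS _ _ K).
Local Notation Aword := (Aword K).
Local Notation Aelt := (Aelt K).
Local Notation wt := (wt K).
Local Notation th := (theta R).
Local Notation rt := (inW (reflection th)).
Local Notation r0 := (r None).
Local Notation tth := (transl R (corootv th)).

Definition peterson_th : Q := (wt (rootv th))^-1 *: (G tth - 1).

Lemma act_transl mu p : act (transl R mu) (emb p) = emb p.
Proof. by rewrite actK_emb actS_transl. Qed.

Lemma peterson_th_comm p :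
  peterson_th * (emb p *: (1 : Q)) = (emb p *: (1 : Q)) * peterson_th.
Proof. exact/skgrp_comm/act_transl. Qed.

Lemma r0_rt : (r0 * rt = tth)%g.
Proof. by rewrite /= -mulgA -inWM reflectionK inW1 mulg1. Qed.

Lemma act_r0_rt p : act r0 (emb (actS K rt p)) = emb p.
Proof. by rewrite -actK_emb -ractM r0_rt act_transl. Qed.

Lemma Asimple_None : Asimple K None = (wt (rootv th))^-1 *: (G r0 - 1).
Proof. by rewrite /Asimple /divdiff /= wtN invrN scaleNr -scalerN opprB. Qed.

Lemma Aelt_r0 w : Aelt (r0 * inW w)%g = Asimple K None * Aelt (inW w).
Proof.
rewrite -{1}(word_redword (inW w)) -word_cons -Aword_red ?red_r0 //.
by rewrite Aword_cons.
Qed.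

(** The terms of index x combine into xi / theta times r_0 A_x, and together
with A_{r_0} they sum to r_0 r_theta / theta - 1 / theta. *)
Lemma peterson_thE (xi : W R -> S) : xi 1%g = 1 ->
  G rt = \sum_w emb (actS K rt (xi w)) *: Aelt (inW w) ->
  Aelt r0 + \sum_(w | w != 1%g)
     (((wt (rootv th))^-1 * emb (xi w)) *: Aelt (inW w) + emb (xi w) *: Aelt (r0 * inW w)%g)
  = peterson_th.
Proof.
move=> x1 e; set c := (wt (rootv th))^-1.
have term w : (c * emb (xi w)) *: Aelt (inW w) + emb (xi w) *: Aelt (r0 * inW w)%g =
    c *: (emb (xi w) *: (G r0 * Aelt (inW w))).
  rewrite Aelt_r0 Asimple_None -/c skgrpB1_mul -scalerA.
  by rewrite [emb _ *: (c *: _)]scalerA [emb _ * c]mulrC -scalerA -scalerDr -scalerDr addrC subrK.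
rewrite (eq_bigr _ (fun w _ => term w)) -scaler_sumr.
have -> : Aelt r0 = c *: (G r0 - 1).
  by rewrite -(mulg1 r0) -inW1 Aelt_r0 inW1 Aelt1 mulr1 Asimple_None mulg1.
rewrite -scalerDr /peterson_th -/c; congr (_ *: _); rewrite addrAC; congr (_ - _).
have -> : G tth = \sum_w emb (xi w) *: (G r0 * Aelt (inW w)).
  rewrite -r0_rt skgrpM e mulr_sumr; apply: eq_bigr => w _.
  by rewrite skgrp_scale act_r0_rt.
by rewrite [RHS](bigD1 1%g) //= x1 rmorph1 scale1r Aelt1 mulr1.
Qed.

Lemma Aelt_descent x i : ~~ apos (aact x (sr (Some i))) ->
  Aelt x = Aelt (x * r (Some i))%g * Asimple K (Some i).
Proof.
move=> d; rewrite -Aword_rcons Aword_red; last first.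
  rewrite /red word_rcons word_redword -mulgA r_K mulg1 size_rcons.
  by rewrite -/(ell _) -(ell_descent d).
by rewrite word_rcons word_redword -mulgA r_K mulg1.
Qed.

(** A non-zero weight stays non-zero in K when doubled. *)
Lemma two_neq0 : 2 != 0 :> K.
Proof.
apply/eqP => h; apply: (@root_neq0 _ R th).
have : 2 *: rootv th = 0 :> 'rV[int]_n.
  by apply: (@wt_inj _ _ K); rewrite wtZ -(scale0r (rootv th)) wtZ mul0r [2%:~R]h mul0r.
by move/rowP => e; apply/rowP => k; have := e k; rewrite !mxE => /eqP; rewrite mulf_eq0 => /eqP.
Qed.

(** Right multiplication by r_i permutes each coset of W and changes the sign of
z A_i. *)
Lemma coset_sum_Asimple z i mu :
  \sum_w (z * Asimple K (Some i))@_(transl R mu * inW w)%g = 0.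
Proof.
set Z := z * _; set sm := \sum_w _.
have e : sm = - sm.
  rewrite {1}/sm (reindex_inj (mulIg (reflection (simple_root R i)))) -sumrN /=.
  apply: eq_bigr => w _; have : Z * G (r (Some i)) = - Z by rewrite -mulrA Asimple_G mulrN.
  move=> /(congr1 (monalg.mcoeff (transl R mu * inW w)%g)).
  by rewrite skcoef_grpr r_V mcoeffN /= inWM mulgA.
have : 2 * sm = 0 by rewrite mulr_natl mulr2n {1}e addNr.
by move=> /eqP; rewrite mulf_eq0 (negbTE two_neq0) => /eqP.
Qed.

(** The elements commuting with S are supported on translations, which represent
the cosets of W. But A_x has zero sum over every coset as soon as x has a
descent in W. *)
Lemma peterson_uniq c :
  (forall l, Alin c * (wt l *: (1 : Q)) = wt l *: Alin c) ->
  (forall x, Waf0 x -> c@_x = 0) -> Alin c = 0.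
Proof.
move=> hc h0.
have s1 y : (Alin c)@_y != 0 -> y.2 = 1%g.
  by apply: (@twisted_support _ _ _ _ 1%g) => l; rewrite act_weight1.
have cs mu : \sum_w (Alin c)@_(transl R mu * inW w)%g = 0.
  transitivity (\sum_(x <- msupp c) emb c@_x * \sum_w (Aelt x)@_(transl R mu * inW w)%g).
    rewrite (eq_bigr (fun w => \sum_(x <- msupp c) emb c@_x * (Aelt x)@_(transl R mu * inW w)%g)).
      by rewrite exchange_big; apply: eq_bigr => x _; rewrite mulr_sumr.
    by move=> w _; rewrite /Alin raddf_sum /=; apply: eq_bigr => x _; rewrite mcoeffZ.
  apply: big1 => x _; have [/h0 -> |/not_Waf0 [i d]] := classic (Waf0 x).
    by rewrite rmorph0 mul0r.
  rewrite (eq_bigr (fun w => (Aelt (x * r (Some i))%g * Asimple K (Some i))@_(transl R mu * inW w)%g)).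
    by rewrite coset_sum_Asimple mulr0.
  by move=> w _; rewrite (Aelt_descent d).
apply/malgP => y; rewrite mcoeff0; apply/eqP; apply: contraT => ny; have y2 := s1 _ ny.
have := cs y.1; rewrite (bigD1 1%g) //= big1 ?addr0 => [|w w1].
  by move=> /eqP; rewrite -{1}y2 -transl_inW (negbTE ny).
apply/eqP; apply: contraNT w1 => /s1 /=.
by rewrite mul1g => ->.
Qed.

Lemma peterson_uniq2 z z' c d : z = Alin c -> z' = Alin d ->
  (forall p, z * (emb p *: (1 : Q)) = (emb p *: (1 : Q)) * z) ->
  (forall p, z' * (emb p *: (1 : Q)) = (emb p *: (1 : Q)) * z') ->
  (forall x, Waf0 x -> c@_x = d@_x) -> z = z'.
Proof.
move=> zc zd hz hz' e; apply/eqP; rewrite -subr_eq0; apply/eqP.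
have eB : z - z' = Alin (c - d).
  by apply/eqP; rewrite zc zd subr_eq -AlinD subrK.
rewrite eB; apply: peterson_uniq => [l|x /e h]; last by rewrite mcoeffB h subrr.
pose b : Q := wt l *: (1 : Q).
have bz : GRing.comm b z by apply/esym; apply: hz.
have bz' : GRing.comm b z' by apply/esym; apply: hz'.
by rewrite -eB -(commrB bz bz') skconst_mul.
Qed.

Lemma Alin_closed (P : Q -> Prop) :
  (forall p, P (emb p *: (1 : Q))) -> (forall i, P (Asimple K i)) ->
  (forall z z', P z -> P z' -> P (z - z')) ->
  (forall z z', P z -> P z' -> P (z * z')) -> forall c, P (Alin c).
Proof.
move=> PS PA PB PM c.
have P0 : P 0 by have := PS 0; rewrite rmorph0 scale0r.
have PD z z' : P z -> P z' -> P (z + z').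
  by move=> h h'; rewrite -[z']opprK -[- z']sub0r; apply: (PB) => //; apply: PB.
apply: big_ind => // x _; rewrite -[Aelt x]mul1r skscaleAl; apply: (PM) => //.
apply: big_ind => //; by have := PS 1; rewrite rmorph1 scale1r.
Qed.

(** The terms other than A_(r_0) are indexed by x and r_0 x with x <> 1 in W,
which are longer than 1 and r_0 in the same cosets. *)
Lemma peterson_th_comb (xi : W R -> S) : xi 1%g = 1 ->
  G rt = \sum_w emb (actS K rt (xi w)) *: Aelt (inW w) ->
  (forall w, w != 1%g -> exists s, xi w = wtS K (rootv th) * s) ->
  exists c, [/\ peterson_th = Alin c, c@_r0 = 1 &
    forall x, Waf0 x -> x <> r0 -> c@_x = 0].
Proof.
move=> x1 e dv.
have [s es] : exists s : W R -> S, forall w, w != 1%g -> xi w = wtS K (rootv th) * s w.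
  apply: (@fin_all_exists _ _ (fun w s => w != 1%g -> xi w = wtS K (rootv th) * s)) => w.
  have [->|/dv [s h]] := eqVneq w 1%g; first by exists 0.
  by exists s.
exists (mono 1 r0 + \sum_(w | w != 1%g) (mono (s w) (inW w) + mono (xi w) (r0 * inW w)%g)).
split.
- rewrite -(peterson_thE x1 e) AlinD AlinU rmorph1 scale1r Alin_sum; congr (_ + _).
  have k w : w != 1%g -> (wt (rootv th))^-1 * emb (xi w) = emb (s w).
    move=> w1; rewrite (es w w1) rmorphM -/(wt _).
    by rewrite mulrA mulVf ?mul1r // wt_root_neq0.
  apply: eq_bigr => w w1.
  by rewrite (k w w1) AlinD; congr (_ + _); rewrite AlinU.
- rewrite mcoeffD mono_coef eqxx mulr1n raddf_sum big1 ?addr0 // => w w1 /=.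
  rewrite mcoeffD !mono_coef.
  case: eqP => [/esym /r0_neq_inW //|_].
  case: eqP => [/(canRL (mulKg _))|_]; last by rewrite !mulr0n addr0.
  by rewrite mulVg => /inW_inj z; rewrite z eqxx in w1.
- move=> x xm xr; rewrite mcoeffD mono_coef raddf_sum.
  case: eqP => [/esym //|_]; rewrite mulr0n add0r big1 // => w w1 /=.
  rewrite mcoeffD !mono_coef.
  case: eqP => [z|_]; first by rewrite -z in xm; rewrite (Waf0_inW xm) eqxx in w1.
  case: eqP => [z|_]; first by rewrite -z in xm; rewrite (Waf0_r0 xm) eqxx in w1.
  by rewrite !mulr0n addr0.
Qed.

End PetersonElement.

(** * The polynomial ring of the weight lattice *)

Section Instance.
Context (n : nat) (R : simpleRootDatum n).

Lemma weightB (l m : 'rV[int]_n) : weight (l - m) = weight l - weight m.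
Proof. by rewrite /weight -sumrB; apply: eq_bigr => i _; rewrite !mxE scalerBl. Qed.

Lemma weightZ k (l : 'rV[int]_n) : weight (k *: l) = k%:~R * weight l.
Proof.
rewrite mulrzl -scaler_int intz /weight scaler_sumr.
by apply: eq_bigr => i _; rewrite !mxE scalerA.
Qed.

Lemma weight_inj : injective (@weight n).
Proof.
move=> l m e; apply/rowP => i.
have H (k : 'rV[int]_n) : mpoly.mcoeff (mpoly.mnm1 i) (weight k) = k 0 i.
  rewrite /weight raddf_sum (bigD1 i) //= mpoly.mcoeffZ mpoly.mcoeffXU eqxx mulr1.
  rewrite big1 ?addr0 // => j /negbTE ji.
  by rewrite mpoly.mcoeffZ mpoly.mcoeffXU ji mulr0.
by rewrite -(H l) e H.
Qed.

Lemma tofrac_inj : injective (@FracField.tofrac (SymP n)).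
Proof. by move=> p q /eqP; rewrite tofrac_eq => /eqP. Qed.

Lemma levelZero_tofrac (x : Waf R) (p : SymP n) :
  levelZero R x p%:F = (act_Sym x.2 p : SymP n)%:F.
Proof. exact: fracmap_tofrac. Qed.

Definition symScalars : scalars R :=
  @Scalars n R (FracSymP n) (SymP n) (@FracField.tofrac (SymP n)) tofrac_inj
    (levelZero R) (fun x => act_Sym x.2) levelZero_tofrac
    (@weight n) weightB weightZ weight_inj
    (fun x => act_Sym_weight x.2) (fun _ => @act_Sym1 n R).

Local Notation K := symScalars.

(** The family and the element chosen by the definitions of xi and j_ are
identified through the uniqueness of the coefficients in the basis A_x. *)
Lemma xiE (w : Waf R) (d : {malg (SymP n)[Waf R]}) :
  grp w = Alin (K := K) d -> forall v, xi v w = (-1) ^+ ell v * d@_v.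
Proof.
move=> e v; rewrite /xi.
have spec : grp w = Alin (K := K) (twist (K := K) (xi_family w)).
  rewrite Alin_twist.
  apply: (epsilon_spec (inhabits 0) (fun c : {malg (SymP n)[Waf R]} =>
    grp w = \sum_(v <- msupp c) ((-1) ^+ ell v * c@_v)%:F *: Aw v)).
  exists (twist (K := K) d); exact: (etrans e (Alin_untwist (K := K) d)).
have <- : twist (K := K) (xi_family w) = d.
  exact: (@Alin_inj _ _ K) (etrans (esym spec) e).
exact: (untwist_coef (K := K)).
Qed.

Lemma j_E (w : Waf R) (z : QWaf R) : is_j w z -> j_ w = z.
Proof.
move=> h; have : is_j w (j_ w) by apply: (epsilon_spec (inhabits 0)); exists z.
case: h => [[_ hz] [d [ed dw d0]]] [[_ hj] [c [ec cw c0]]].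
have cd x : Waf0 x -> c@_x = d@_x.
  move=> xm; have [->|/eqP xw] := eqVneq x w; first by rewrite cw dw.
  by rewrite c0 // d0.
exact: (@peterson_uniq2 _ _ K _ _ c d ec ed hj hz cd).
Qed.

End Instance.

Theorem theorem6 (n : nat) (R : simpleRootDatum n) :
  let r_theta : Waf R := inW (reflection (theta R)) in
  let r0 : Waf R := r_ R None in
  let th : SymP n := weight (rootv (theta R)) in
  (forall x : Waf R, x <> 1%g ->
     exists s : SymP n, xi x^-1%g r_theta = th * s) /\
  j_ r0 = Aw r0 +
    \sum_(x : W R | x != 1%g)
      ((th%:F^-1 * (xi (inW x)^-1%g r_theta)%:F) *: Aw (inW x)
       + (xi (inW x)^-1%g r_theta)%:F *: Aw (r0 * inW x)%g).
Proof.
move=> rt r0 th; have [d [e /(_ (fun v => xi v rt) (xiE e)) [x1 xdiv xsum]]] := theta_xi (symScalars R).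
split; first exact: xdiv.
have fdiv (w : W R) : w != 1%g -> exists s : SymP n, xi (inW w)^-1%g rt = th * s.
  by move=> w1; apply: xdiv => /inW_inj w1'; rewrite w1' eqxx in w1.
pose f (w : W R) : SymP n := xi (inW w)^-1%g rt.
have f1 : f 1%g = 1 by rewrite /f inW1 invg1.
have [c [ec c1 c0]] := peterson_th_comb (K := symScalars R) (xi := f) f1 xsum fdiv.
transitivity (peterson_th (symScalars R)); last exact: esym (peterson_thE (K := symScalars R) (xi := f) f1 xsum).
apply: j_E; split; last by exists c.
split; last exact: (@peterson_th_comm _ _ (symScalars R)).
rewrite ec; apply: (Alin_closed (K := symScalars R)).
- exact: nilHecke_Sym.
- exact: nilHecke_A.
- exact: nilHecke_sub.
- exact: nilHecke_mul.
Qed.
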